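(* Let $A,B$ be real numbers with $-1<B<A\leq1$ and $B\neq0$, let $\varphi_{Ne}(z):=1+z-z^3/3$, let $p\in\mathcal{H}$ satisfy $p(0)=1$, and let $\beta\in\mathbb{R}$. Then each of the following differential subordinations ensures the subordination $p\prec\varphi_{Ne}$: (a) $1+\beta zp'(z)\prec\dfrac{1+Az}{1+Bz}$ for $\beta\geq\max\{\beta_1,\beta_2\}$, where $$\beta_1=\frac{A-B}{2B}\log\left((1-B)^{-3}\right)\quad\text{and}\quad\beta_2=\frac{A-B}{2B}\log\left((1+B)^{3}\right);$$ (b) $1+\beta\,\dfrac{zp'(z)}{p(z)}\prec\dfrac{1+Az}{1+Bz}$ for $\beta\geq\max\{\beta_1,\beta_2\}$, where $$\beta_1=\frac{A-B}{B\log3}\log\left((1-B)^{-1}\right)\quad\text{and}\quad\beta_2=\frac{A-B}{B\log(5/3)}\log(1+B);$$ (c) $1+\beta\,\dfrac{zp'(z)}{p^2(z)}\prec\dfrac{1+Az}{1+Bz}$ for $\beta\geq\max\{\beta_1,\beta_2\}$, where $$\beta_1=\frac{A-B}{2B}\log\left((1-B)^{-1}\right)\quad\text{and}\quad\beta_2=\frac{A-B}{2B}\log\left((1+B)^{5}\right).$$ Moreover, the respective estimates on the real number $\beta$ are best possible.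
   Context: $\mathbb{D}=\{z\in\mathbb{C}:|z|<1\}$ and $\mathcal{H}$ is the set of all analytic functions on $\mathbb{D}$. For $f,g\in\mathcal{H}$, $f\prec g$ ($f$ is subordinate to $g$) means that there is $w\in\mathcal{H}$ with $w(0)=0$ and $|w(z)|<1$ for $z\in\mathbb{D}$ such that $f(z)=g(w(z))$ on $\mathbb{D}$; in particular, writing a subordination presupposes that both sides are analytic in $\mathbb{D}$. $\log$ of a positive number is the natural logarithm. That an estimate $\beta\ge\beta_0$ is best possible means that, for the given $A,B$, $\beta_0$ cannot be replaced by any smaller real number so that the implication remains valid for all such $p$ and all $\beta$ at least that number. *)

(* Defs.v *)
From Stdlib Require Import Reals.
From Coquelicot Require Import Coquelicot.

Local Open Scope C_scope.

(** The class H.  Functions are total on [C]; only their values on the unit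
    disc matter. *)
Definition analytic_on_disc (f : C -> C) : Prop :=
  forall z : C, (Cmod z < 1)%R ->
    ex_derive (K := C_AbsRing) (V := C_NormedModule) f z.

Definition subordinate (f g : C -> C) : Prop :=
  analytic_on_disc f /\ analytic_on_disc g /\
  exists w : C -> C,
    analytic_on_disc w /\ w 0 = 0 /\
    (forall z : C, (Cmod z < 1)%R -> (Cmod (w z) < 1)%R) /\
    (forall z : C, (Cmod z < 1)%R -> f z = g (w z)).

Definition phi_Ne (z : C) : C := 1 + z - z ^ 3 / 3.

Definition janowski (A B : R) (z : C) : C := (1 + A * z) / (1 + B * z).

(** Division in [C] is total ([/ 0 = 0]).  In the last two expressions a zero of
    [p] in the disc is a pole of the quotient (when [p 0 = 1]), so for
    [beta <> 0] the analyticity required by [subordinate] forces [p] to be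
    zero-free there; for [beta = 0] both expressions are the constant 1. *)
Definition expr_a (beta : R) (p : C -> C) (z : C) : C :=
  1 + beta * (z * C_derive p z).

Definition expr_b (beta : R) (p : C -> C) (z : C) : C :=
  1 + beta * (z * C_derive p z / p z).

Definition expr_c (beta : R) (p : C -> C) (z : C) : C :=
  1 + beta * (z * C_derive p z / (p z) ^ 2).

Definition implication_from
    (expr : R -> (C -> C) -> C -> C) (A B b : R) : Prop :=
  forall (beta : R) (p : C -> C),
    (b <= beta)%R ->
    analytic_on_disc p -> p 0 = 1 ->
    subordinate (expr beta p) (janowski A B) ->
    subordinate p phi_Ne.

Definition best_possible
    (expr : R -> (C -> C) -> C -> C) (A B beta0 : R) : Prop :=
  forall b : R, (b < beta0)%R -> ~ implication_from expr A B b.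

(* Main.v *)
Require Import Defs.
From Stdlib Require Import Reals Lra Classical ClassicalEpsilon.
From Coquelicot Require Import Coquelicot.
Local Open Scope R_scope.

(** Put [c = (A - B) / (beta B)] and write [p = 1 + F], [p = exp F] and
    [p = 1 / (1 - F)] in (a), (b) and (c).  The hypothesis becomes
    [z F' = c B w / (1 + B w)] with [|w| < 1], and the theorem follows from
    [F = c log (1 + v)], [|v| < |B|].  Indeed the image of that set under each of
    the three maps lies in the disc [|p - 1| < 2/3] exactly when its real points
    do, and this disc, the largest one about [1] inside the nephroid domain,
    touches the nephroid at [1/3] and [5/3].  The representation of [F] is Jack's
    lemma for [exp (F / c) - 1].  Since no Cauchy theory is used, the maximum
    principle behind it is proved from the second derivative test, applied to
    [|u|^2 + eps |z|^2] in the directions [1] and [i]; the hypothesis makes [F]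
    twice differentiable away from the origin.  Sharpness is seen on
    [F = c log (1 + B z)] and the real points of the nephroid domain. *)

(** * Complex derivatives *)

(** The constants come from real points only. With [Th x] equal to [1 + x], [exp x] and
    [1 / (1 - x)], the numbers [t1], [t2] of each part solve [Th (- t1) = 1/3] and [Th t2 = 5/3]:
    they are [2/3, 2/3], then [ln 3, ln (5/3)], then [2, 2/5]. For [beta > 0] the product
    [c B = (A - B) / beta] is positive, so on [-1 < x < 1] the values of [c log (1 + B x)] run from
    [c log (1 - B) < 0] to [c log (1 + B) > 0] for either sign of [B], and the two bounds on [beta]
    say that these ends stay in [[- t1, t2]]. The second bound is itself positive, which forces
    [beta > 0]. The obstacle in (b) and (c) is that [log p] and [1 - 1/p] make sense only where [p]
    has no zeros, and the principal logarithm only where [Re p > 0]. A continuity argument removes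
    it: on a disc where [|p - 1| < 1] the estimates apply and improve the bound to [2/3], so
    [|p - 1|] never reaches [1]. This is why the lemmas on [F] are stated for a radius [r]. *)

Definition cder (f : C -> C) (z d : C) : Prop :=
  forall eps : R, 0 < eps -> exists delta : R, 0 < delta /\
    forall y : C, Cmod (y - z) < delta ->
      Cmod (f y - f z - d * (y - z)) <= eps * Cmod (y - z).

Definition ccont (f : C -> C) (z : C) : Prop :=
  forall eps : R, 0 < eps -> exists delta : R, 0 < delta /\
    forall y : C, Cmod (y - z) < delta -> Cmod (f y - f z) < eps.

Definition cnear (z : C) (P : C -> Prop) : Prop :=
  exists delta : R, 0 < delta /\ forall y : C, Cmod (y - z) < delta -> P y.

Lemma cder_is_derive (f : C -> C) (z d : C) :
  cder f z d <-> is_derive (K := C_AbsRing) (V := C_NormedModule) f z d.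
Proof.
  split.
  - intros H. split.
    + apply (is_linear_scal_l (K := C_AbsRing) (V := C_NormedModule)).
    + intros x Hx.
      assert (E : z = x) by exact (is_filter_lim_locally_unique (V := AbsRing_NormedModule C_AbsRing) z x Hx).
      rewrite <- E. intros eps.
      destruct (H eps (cond_pos eps)) as [dl [Hd H']].
      exists (mkposreal dl Hd). intros y Hy.
      change (Cmod (f y - f z - (y - z) * d) <= eps * Cmod (y - z)).
      rewrite (Cmult_comm (y - z)). exact (H' y Hy).
  - intros [_ H] eps He.
    destruct (H z (fun P HP => HP) (mkposreal eps He)) as [dl Hd].
    exists dl. split; [apply cond_pos|].
    intros y Hy. rewrite (Cmult_comm d). exact (Hd y Hy).
Qed.

(** The product rule, and the inner function of the chain rule, use the module structure of the ring
    on itself, whereas the statement uses [C_NormedModule]; [cder] is the common form through which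
    one passes from one to the other. *)
Lemma cder_is_derive_ring (f : C -> C) (z d : C) :
  cder f z d <-> is_derive (K := C_AbsRing) (V := AbsRing_NormedModule C_AbsRing) f z d.
Proof.
  split.
  - intros H. split.
    + apply (is_linear_scal_l (K := C_AbsRing) (V := AbsRing_NormedModule C_AbsRing)).
    + intros x Hx.
      assert (E : z = x) by exact (is_filter_lim_locally_unique (V := AbsRing_NormedModule C_AbsRing) z x Hx).
      rewrite <- E. intros eps.
      destruct (H eps (cond_pos eps)) as [dl [Hd H']].
      exists (mkposreal dl Hd). intros y Hy.
      change (Cmod (f y - f z - (y - z) * d) <= eps * Cmod (y - z)).
      rewrite (Cmult_comm (y - z)). exact (H' y Hy).
  - intros [_ H] eps He.
    destruct (H z (fun P HP => HP) (mkposreal eps He)) as [dl Hd].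
    exists dl. split; [apply cond_pos|].
    intros y Hy. rewrite (Cmult_comm d). exact (Hd y Hy).
Qed.

Lemma cnear_lt (z : C) (r : R) : Cmod z < r -> cnear z (fun y => Cmod y < r).
Proof.
  intros H. exists (r - Cmod z). split; [lra|]. intros y Hy.
  replace y with (z + (y - z))%C by ring.
  pose proof (Cmod_triangle z (y - z)). lra.
Qed.

Lemma cnear_and (z : C) (P Q : C -> Prop) :
  cnear z P -> cnear z Q -> cnear z (fun y => P y /\ Q y).
Proof.
  intros [d1 [H1 K1]] [d2 [H2 K2]]. exists (Rmin d1 d2).
  split; [apply Rmin_pos; assumption|]. intros y Hy. split.
  - apply K1. eapply Rlt_le_trans; [exact Hy|apply Rmin_l].
  - apply K2. eapply Rlt_le_trans; [exact Hy|apply Rmin_r].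
Qed.

Lemma cnear_imp (z : C) (P Q : C -> Prop) :
  (forall y, P y -> Q y) -> cnear z P -> cnear z Q.
Proof. intros H [d [Hd K]]. exists d. split; auto. Qed.

Lemma Cmod_sub_self (z : C) : Cmod (z - z) = 0.
Proof. replace (z - z)%C with (RtoC 0) by ring. apply Cmod_0. Qed.

Lemma cnear_at (z : C) (P : C -> Prop) : cnear z P -> P z.
Proof. intros [d [Hd K]]. apply K. rewrite Cmod_sub_self. exact Hd. Qed.

Lemma cder_ext_loc (f g : C -> C) (z d : C) :
  cnear z (fun y => f y = g y) -> cder f z d -> cder g z d.
Proof.
  intros H D eps He. destruct (D eps He) as [d1 [H1 K1]].
  pose proof (cnear_at _ _ H) as Ez. cbv beta in Ez.
  destruct H as [d2 [H2 K2]].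
  exists (Rmin d1 d2). split; [apply Rmin_pos; assumption|]. intros y Hy.
  rewrite <- Ez, <- K2.
  - apply K1. eapply Rlt_le_trans; [exact Hy|apply Rmin_l].
  - eapply Rlt_le_trans; [exact Hy|apply Rmin_r].
Qed.

Lemma cder_ext (f g : C -> C) (z d : C) :
  (forall y, f y = g y) -> cder f z d -> cder g z d.
Proof. intros H. apply cder_ext_loc. exists 1. split; [lra|auto]. Qed.

Lemma cder_eq (f : C -> C) (z d e : C) : cder f z d -> d = e -> cder f z e.
Proof. intros H <-. exact H. Qed.

Lemma cder_const (k z : C) : cder (fun _ => k) z 0%C.
Proof.
  intros eps He. exists 1. split; [lra|]. intros y _.
  replace (k - k - 0 * (y - z))%C with (RtoC 0) by ring.
  rewrite Cmod_0. pose proof (Cmod_ge_0 (y - z)). nra.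
Qed.

Lemma cder_id (z : C) : cder (fun y => y) z 1%C.
Proof.
  intros eps He. exists 1. split; [lra|]. intros y _.
  replace (y - z - 1 * (y - z))%C with (RtoC 0) by ring.
  rewrite Cmod_0. pose proof (Cmod_ge_0 (y - z)). nra.
Qed.

Lemma cder_plus (f g : C -> C) (z a b : C) :
  cder f z a -> cder g z b -> cder (fun y => f y + g y)%C z (a + b)%C.
Proof.
  rewrite !cder_is_derive. intros Hf Hg.
  exact (is_derive_plus (K := C_AbsRing) (V := C_NormedModule) f g z a b Hf Hg).
Qed.

Lemma cder_mult (f g : C -> C) (z a b : C) :
  cder f z a -> cder g z b ->
  cder (fun y => f y * g y)%C z (a * g z + f z * b)%C.
Proof.
  rewrite !cder_is_derive_ring. intros Hf Hg.
  exact (is_derive_mult (K := C_AbsRing) f g z a b Hf Hg Cmult_comm).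
Qed.

Lemma cder_comp (f g : C -> C) (z a b : C) :
  cder f (g z) a -> cder g z b -> cder (fun y => f (g y)) z (a * b)%C.
Proof.
  intros Hf Hg. apply (cder_eq _ _ (b * a)%C); [|ring].
  rewrite cder_is_derive in Hf |- *. rewrite cder_is_derive_ring in Hg.
  exact (is_derive_comp (K := C_AbsRing) (V := C_NormedModule) f g z a b Hf Hg).
Qed.

Lemma cder_scal (k : C) (f : C -> C) (z a : C) :
  cder f z a -> cder (fun y => k * f y)%C z (k * a)%C.
Proof.
  intros H. eapply cder_eq; [apply (cder_mult _ _ _ _ _ (cder_const k z) H)|].
  ring.
Qed.

Lemma cder_opp (f : C -> C) (z a : C) :
  cder f z a -> cder (fun y => - f y)%C z (- a)%C.
Proof.
  intros H. apply cder_ext with (fun y => (- (1)) * f y)%C; [intros; ring|].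
  eapply cder_eq; [apply cder_scal, H|ring].
Qed.

Lemma cder_minus (f g : C -> C) (z a b : C) :
  cder f z a -> cder g z b -> cder (fun y => f y - g y)%C z (a - b)%C.
Proof. intros Hf Hg. apply cder_plus; [exact Hf|apply cder_opp, Hg]. Qed.

Lemma cder_ccont (f : C -> C) (z d : C) : cder f z d -> ccont f z.
Proof.
  intros D eps He. destruct (D 1 Rlt_0_1) as [d1 [H1 K1]].
  set (m := 1 + Cmod d). assert (Hm : 0 < m).
  { unfold m. pose proof (Cmod_ge_0 d). lra. }
  exists (Rmin d1 (eps / m)).
  split; [apply Rmin_pos; [exact H1|apply Rdiv_lt_0_compat; lra]|].
  intros y Hy.
  assert (Hy1 : Cmod (y - z) < d1)
    by (eapply Rlt_le_trans; [exact Hy|apply Rmin_l]).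
  assert (Hy2 : Cmod (y - z) < eps / m)
    by (eapply Rlt_le_trans; [exact Hy|apply Rmin_r]).
  specialize (K1 y Hy1).
  replace (f y - f z)%C with ((f y - f z - d * (y - z)) + d * (y - z))%C by ring.
  eapply Rle_lt_trans; [apply Cmod_triangle|]. rewrite Cmod_mult.
  apply (Rmult_lt_compat_r m) in Hy2; [|exact Hm].
  replace (eps / m * m) with eps in Hy2 by (field; lra).
  unfold m in Hy2. lra.
Qed.

Lemma Cmod_sub_lower (a b : C) : Cmod a - Cmod b <= Cmod (a - b).
Proof.
  pose proof (Cmod_triangle (a - b) b).
  replace (a - b + b)%C with a in H by ring. lra.
Qed.

Lemma Cmod_sub_sym (a b : C) : Cmod (a - b) = Cmod (b - a).
Proof. rewrite <- Cmod_opp. f_equal. ring. Qed.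

(** If [p = f o g] near [z0] with [g] continuous at [z0] and [f' <> 0] at
    [g z0], then [g] inherits a derivative from [p]. *)
Lemma cder_inverse (f g p : C -> C) (z d e : C) :
  cnear z (fun y => f (g y) = p y) -> ccont g z ->
  cder f (g z) d -> d <> 0%C -> cder p z e -> cder g z (e / d)%C.
Proof.
  intros Heq Hg Hf Hd Hp eps He.
  assert (Dp : 0 < Cmod d) by (apply Cmod_gt_0, Hd).
  set (q := (e / d)%C).
  assert (Hq := Cmod_ge_0 q).
  (* As [eta <= |d| / 2], the term [eta * |G - q Y|] of the final estimate is absorbed into the left
     side [|d| * |G - q Y|]; the two remaining error terms cost at most [eps * |d| / 4 * |Y|]
     each. *)
  set (eta := Rmin (Cmod d / 2) (eps * Cmod d / (4 * (1 + Cmod q)))).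
  assert (Heta : 0 < eta).
  { apply Rmin_pos; [lra|]. apply Rdiv_lt_0_compat; [|lra].
    apply Rmult_lt_0_compat; lra. }
  set (xi := Rmin (Cmod d / 2) (eps * Cmod d / 4)).
  assert (Hxi : 0 < xi).
  { apply Rmin_pos; [lra|]. nra. }
  assert (N1 : cnear z (fun y => Cmod (f (g y) - f (g z) - d * (g y - g z))
       <= eta * Cmod (g y - g z))).
  { destruct (Hf eta Heta) as [d1 [H1 K1]].
    destruct (Hg d1 H1) as [d2 [H2 K2]]. exists d2. split; auto. }
  destruct (cnear_and _ _ _ N1 (cnear_and _ _ _ Heq (Hp xi Hxi)))
    as [dl [Hdl K]].
  exists dl. split; [exact Hdl|]. intros y Hy.
  pose proof (cnear_at _ _ Heq) as Ez. cbv beta in Ez.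
  destruct (K y Hy) as [K1 [K2 K3]]. rewrite K2, Ez in K1.
  set (G := (g y - g z)%C) in *. set (Y := (y - z)%C) in *.
  set (P := (p y - p z)%C) in *.
  assert (E1 : Cmod d * Cmod (G - q * Y)
     <= eta * Cmod G + xi * Cmod Y).
  { rewrite <- Cmod_mult.
    replace (d * (G - q * Y))%C with ((P - e * Y) - (P - d * G))%C
      by (unfold q; field; exact Hd).
    unfold Cminus at 1. eapply Rle_trans; [apply Cmod_triangle|].
    rewrite Cmod_opp. lra. }
  assert (E2 : Cmod G <= Cmod (G - q * Y) + Cmod q * Cmod Y).
  { rewrite <- Cmod_mult.
    replace G with ((G - q * Y) + q * Y)%C at 1 by ring.
    apply Cmod_triangle. }
  pose proof (Cmod_ge_0 Y). pose proof (Cmod_ge_0 G).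
  pose proof (Cmod_ge_0 (G - q * Y)).
  assert (eta <= Cmod d / 2) by apply Rmin_l.
  assert (eta * (1 + Cmod q) <= eps * Cmod d / 4).
  { assert (eta <= eps * Cmod d / (4 * (1 + Cmod q))) by apply Rmin_r.
    apply (Rmult_le_compat_r (1 + Cmod q)) in H3; [|lra].
    replace (eps * Cmod d / (4 * (1 + Cmod q)) * (1 + Cmod q))
      with (eps * Cmod d / 4) in H3 by (field; lra). exact H3. }
  assert (xi <= eps * Cmod d / 4) by apply Rmin_r.
  assert (eta * Cmod G <= eta * (Cmod (G - q * Y) + Cmod q * Cmod Y))
    by (apply Rmult_le_compat_l; lra).
  assert (eta * Cmod (G - q * Y) <= Cmod d / 2 * Cmod (G - q * Y))
    by (apply Rmult_le_compat_r; lra).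
  assert (eta * Cmod q * Cmod Y <= eps * Cmod d / 4 * Cmod Y)
    by (apply Rmult_le_compat_r; nra).
  assert (xi * Cmod Y <= eps * Cmod d / 4 * Cmod Y)
    by (apply Rmult_le_compat_r; lra).
  apply (Rmult_le_reg_l (Cmod d / 2)); [lra|]. nra.
Qed.

Lemma ccont_inv (z : C) : z <> 0%C -> ccont (fun y => / y)%C z.
Proof.
  intros Hz eps He. assert (Hp : 0 < Cmod z) by (apply Cmod_gt_0, Hz).
  assert (Hm : 0 < eps * (Cmod z * Cmod z)) by (apply Rmult_lt_0_compat; nra).
  exists (Rmin (Cmod z / 2) (eps * (Cmod z * Cmod z) / 2)). split.
  { apply Rmin_pos; lra. }
  intros y Hy.
  assert (Hy1 : Cmod (y - z) < Cmod z / 2)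
    by (eapply Rlt_le_trans; [exact Hy|apply Rmin_l]).
  assert (Hy2 : Cmod (y - z) < eps * (Cmod z * Cmod z) / 2)
    by (eapply Rlt_le_trans; [exact Hy|apply Rmin_r]).
  pose proof (Cmod_sub_lower z y). rewrite Cmod_sub_sym in H.
  assert (Hy0 : y <> 0%C) by (apply Cmod_gt_0; lra).
  replace (/ y - / z)%C with (- ((y - z) * / (y * z)))%C by (field; auto).
  assert (Hyz : (y * z)%C <> 0%C) by (apply Cmult_neq_0; auto).
  rewrite Cmod_opp, Cmod_mult, Cmod_inv, Cmod_mult by exact Hyz.
  apply (Rmult_lt_reg_r (Cmod y * Cmod z)); [nra|].
  rewrite Rmult_assoc, Rinv_l, Rmult_1_r by nra. nra.
Qed.

(** The first-order remainder of inversion at [k] is [- (/ y - / k) * / k * (y - k)], so continuity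
    of inversion already gives its derivative. *)
Lemma cder_inv (f : C -> C) (z a : C) :
  f z <> 0%C -> cder f z a ->
  cder (fun y => / f y)%C z (- a / (f z * f z))%C.
Proof.
  intros Hz Hf.
  assert (D : cder (fun y => / y)%C (f z) (- (1) / (f z * f z))%C).
  { intros eps He. assert (Hm : 0 < Cmod (f z)) by (apply Cmod_gt_0, Hz).
    destruct (ccont_inv (f z) Hz (eps * Cmod (f z))) as [d1 [H1 K1]];
      [nra|].
    exists (Rmin d1 (Cmod (f z))). split; [apply Rmin_pos; assumption|].
    intros y Hy.
    assert (Hy1 : Cmod (y - f z) < d1)
      by (eapply Rlt_le_trans; [exact Hy|apply Rmin_l]).
    assert (Hy2 : Cmod (y - f z) < Cmod (f z))
      by (eapply Rlt_le_trans; [exact Hy|apply Rmin_r]).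
    specialize (K1 y Hy1).
    pose proof (Cmod_sub_lower (f z) y). rewrite Cmod_sub_sym in H.
    assert (Hy0 : y <> 0%C) by (apply Cmod_gt_0; lra).
    replace (/ y - / f z - - (1) / (f z * f z) * (y - f z))%C
      with (- ((/ y - / f z) * / f z * (y - f z)))%C by (field; auto).
    rewrite Cmod_opp, !Cmod_mult, Cmod_inv by exact Hz.
    apply Rmult_le_compat_r; [apply Cmod_ge_0|].
    apply (Rmult_le_reg_r (Cmod (f z))); [exact Hm|].
    rewrite Rmult_assoc, Rinv_l, Rmult_1_r by lra. lra. }
  eapply cder_eq; [apply (cder_comp _ _ _ _ _ D Hf)|]. unfold Cdiv. ring.
Qed.

Lemma cder_div (f g : C -> C) (z a b : C) :
  g z <> 0%C -> cder f z a -> cder g z b ->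
  cder (fun y => f y / g y)%C z ((a * g z - f z * b) / (g z * g z))%C.
Proof.
  intros Hz Hf Hg.
  eapply cder_eq; [apply cder_mult; [exact Hf|apply cder_inv; eassumption]|].
  cbv beta. field. exact Hz.
Qed.

(** * Extrema on compact sets *)

(** Compactness of bounded subsets of the plane, as a principle for passing
    from local to uniform bounds. *)
Lemma compact_uniform (r : R) (Q : R -> C -> Prop) :
  (forall d e z, 0 < d -> d <= e -> Q e z -> Q d z) ->
  (forall z, exists d, 0 < d /\ forall y, Cmod (y - z) < d -> Q d y) ->
  exists d, 0 < d /\ forall z, Cmod z <= r -> Q d z.
Proof.
  intros Hmono Hloc.
  (* The radius is halved because the compactness theorem measures closeness by coordinates, and the
     modulus is at most [sqrt 2 < 2] times the larger coordinate. *)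
  assert (Hc : forall u v : R, {d : posreal | forall y, Cmod (y - (u, v)) < 2 * d -> Q d y}).
  { intros u v. apply ClassicalEpsilon.constructive_indefinite_description.
    destruct (Hloc (u, v)) as [d [Hd K]].
    assert (Hd2 : 0 < d / 2) by lra.
    exists (mkposreal _ Hd2). simpl. intros y Hy.
    apply (Hmono _ d); [lra|lra|]. apply K. lra. }
  destruct (compactness_value_2d (- r) r (- r) r
     (fun u v => proj1_sig (Hc u v))) as [d Hd].
  exists d. split; [apply cond_pos|]. intros z Hz.
  (* The covering point is provided only under a double negation. *)
  apply Classical_Prop.NNPP. intros Hn.
  pose proof (Rmax_Cmod z) as Hm.
  assert (H1 : Rabs (fst z) <= r)
    by (eapply Rle_trans; [apply Rmax_l|]; eapply Rle_trans; eassumption).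
  assert (H2 : Rabs (snd z) <= r)
    by (eapply Rle_trans; [apply Rmax_r|]; eapply Rle_trans; eassumption).
  apply Rabs_le_between in H1, H2.
  apply (Hd (fst z) (snd z) H1 H2). intros (u & v & _ & _ & Hu & Hv & Hdd).
  apply Hn. destruct (Hc u v) as [e He]. simpl in *.
  apply (Hmono _ e); [apply cond_pos|exact Hdd|]. apply He.
  eapply Rle_lt_trans; [apply Cmod_2Rmax|].
  assert (Rmax (Rabs (fst (z - (u, v))%C)) (Rabs (snd (z - (u, v))%C)) < e).
  { apply Rmax_lub_lt; assumption. }
  assert (sqrt 2 < 2).
  { rewrite <- (sqrt_square 2) at 2 by lra. apply sqrt_lt_1; lra. }
  pose proof (sqrt_pos 2).
  assert (0 <= Rmax (Rabs (fst (z - (u, v))%C)) (Rabs (snd (z - (u, v))%C))).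
  { eapply Rle_trans; [apply Rabs_pos|apply Rmax_l]. }
  nra.
Qed.

Definition rcont (g : C -> R) (z : C) : Prop :=
  forall eps : R, 0 < eps -> exists delta : R, 0 < delta /\
    forall y : C, Cmod (y - z) < delta -> Rabs (g y - g z) < eps.

(** Local bounds become a global one, so a supremum [S] exists. If it were not attained, the local
    gaps below [S] would become a uniform gap [e], and [S - e] would be an upper bound. Points
    outside [K] have a neighbourhood on which the condition is vacuous. *)
Lemma compact_max (K : C -> Prop) (r : R) (g : C -> R) (a : C) :
  (forall z, K z -> Cmod z <= r) ->
  (forall z, ~ K z -> cnear z (fun y => ~ K y)) ->
  (forall z, K z -> rcont g z) -> K a ->
  exists z, K z /\ forall y, K y -> g y <= g z.
Proof.
  intros Hb Hcl Hg Ha.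
  (* The bound is written [/ d] because [compact_uniform] asks for a property that survives
     shrinking [d]. *)
  assert (Hbd : exists d, 0 < d /\ forall z, Cmod z <= r -> K z -> g z <= / d).
  { apply (compact_uniform r (fun d z => K z -> g z <= / d)).
    - intros d e z Hd Hde H Kz. specialize (H Kz).
      eapply Rle_trans; [exact H|]. apply Rinv_le_contravar; assumption.
    - intros z. destruct (Classical_Prop.classic (K z)) as [Kz|Kz].
      + destruct (Hg z Kz 1 Rlt_0_1) as [d [Hd H]].
        set (m := Rabs (g z) + 1).
        assert (Hm : 0 < m) by (unfold m; pose proof (Rabs_pos (g z)); lra).
        exists (Rmin d (/ m)).
        assert (Hp : 0 < Rmin d (/ m))
          by (apply Rmin_pos; [exact Hd|apply Rinv_0_lt_compat, Hm]).
        split; [exact Hp|].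
        intros y Hy _. apply Rle_trans with m.
        * specialize (H y ltac:(eapply Rlt_le_trans; [exact Hy|apply Rmin_l])).
          apply Rabs_lt_between in H. pose proof (Rle_abs (g z)).
          unfold m. lra.
        * rewrite <- (Rinv_inv m) at 1. apply Rinv_le_contravar;
            [exact Hp|apply Rmin_r].
      + destruct (Hcl z Kz) as [d [Hd H]]. exists d. split; [exact Hd|].
        intros y Hy Ky. exfalso. exact (H y Hy Ky). }
  destruct Hbd as [d [Hd Hbd]].
  destruct (completeness (fun x => exists z, K z /\ x = g z)) as [S [HS1 HS2]].
  { exists (/ d). intros x [z [Kz ->]]. apply Hbd; auto. }
  { exists (g a), a. auto. }
  apply Classical_Prop.NNPP. intros Hn.
  assert (Hlt : forall z, K z -> g z < S).
  { intros z Kz. destruct (Rlt_or_le (g z) S) as [H|H]; [exact H|].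
    exfalso. apply Hn. exists z. split; [exact Kz|]. intros y Ky.
    apply Rle_trans with S; [|exact H]. apply HS1. exists y. auto. }
  assert (Hun : exists e, 0 < e /\ forall z, Cmod z <= r -> K z -> g z <= S - e).
  { apply (compact_uniform r (fun e z => K z -> g z <= S - e)).
    - intros e e' z He Hee H Kz. specialize (H Kz). lra.
    - intros z. destruct (Classical_Prop.classic (K z)) as [Kz|Kz].
      + specialize (Hlt z Kz).
        destruct (Hg z Kz ((S - g z) / 2)) as [e [He H]]; [lra|].
        exists (Rmin e ((S - g z) / 2)).
        split; [apply Rmin_pos; lra|]. intros y Hy _.
        specialize (H y ltac:(eapply Rlt_le_trans; [exact Hy|apply Rmin_l])).
        apply Rabs_lt_between in H. pose proof (Rmin_r e ((S - g z) / 2)). lra.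
      + destruct (Hcl z Kz) as [e [He H]]. exists e. split; [exact He|].
        intros y Hy Ky. exfalso. exact (H y Hy Ky). }
  destruct Hun as [e [He Hun]].
  assert (S <= S - e).
  { apply HS2. intros x [z [Kz ->]]. apply Hun; auto. }
  lra.
Qed.

(** * The maximum principle *)

Lemma Im_le_Cmod (z : C) : Rabs (Im z) <= Cmod z.
Proof. eapply Rle_trans; [apply Rmax_r|apply Rmax_Cmod]. Qed.

Lemma small_o_derivative (g : R -> R) (t l K : R) :
  (forall eps, 0 < eps -> exists delta, 0 < delta /\ forall h, Rabs h < delta ->
     Rabs (g (t + h) - g t - l * h) <= eps * (K * Rabs h)) ->
  0 <= K -> is_derive g t l.
Proof.
  intros H HK. apply is_derive_Reals. intros eps He.
  assert (He2 : 0 < eps / (2 * (K + 1))) by (apply Rdiv_lt_0_compat; lra).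
  destruct (H _ He2) as [d [Hd Hh]]. exists (mkposreal d Hd).
  intros h h0 hd. simpl in hd. specialize (Hh h hd).
  assert (hp : 0 < Rabs h) by (apply Rabs_pos_lt, h0).
  replace ((g (t + h) - g t) / h - l) with ((g (t + h) - g t - l * h) / h)
    by (field; exact h0).
  unfold Rdiv. rewrite Rabs_mult, Rabs_inv.
  apply (Rmult_lt_reg_r (Rabs h)); [exact hp|].
  rewrite Rmult_assoc, Rinv_l, Rmult_1_r by lra.
  eapply Rle_lt_trans; [exact Hh|].
  replace (eps / (2 * (K + 1)) * (K * Rabs h))
    with ((eps * Rabs h) * (K / (2 * (K + 1)))) by (field; lra).
  rewrite <- (Rmult_1_r (eps * Rabs h)) at 2.
  apply Rmult_lt_compat_l; [apply Rmult_lt_0_compat; lra|].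
  apply (Rmult_lt_reg_r (2 * (K + 1))); [lra|].
  unfold Rdiv. rewrite Rmult_assoc, Rinv_l; lra.
Qed.

Lemma line_derivative (f : C -> C) (z e d : C) (t : R) :
  cder f (z + t * e)%C d ->
  is_derive (fun x : R => Re (f (z + x * e)%C)) t (Re (d * e)) /\
  is_derive (fun x : R => Im (f (z + x * e)%C)) t (Im (d * e)).
Proof.
  intros D.
  assert (Hs : forall eps, 0 < eps -> exists delta, 0 < delta /\
     forall h, Rabs h < delta ->
     Cmod (f (z + (t + h)%R * e)%C - f (z + t * e)%C - d * e * h)%C
       <= eps * (Cmod e * Rabs h)).
  { intros eps He. destruct (D eps He) as [d1 [H1 K1]].
    pose proof (Cmod_ge_0 e) as E0.
    exists (d1 / (Cmod e + 1)). split; [apply Rdiv_lt_0_compat; lra|].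
    intros h Hh.
    assert (E : ((z + (t + h)%R * e) - (z + t * e))%C = (e * h)%C)
      by (rewrite RtoC_plus; ring).
    specialize (K1 (z + (t + h)%R * e)%C). rewrite E in K1.
    rewrite Cmod_mult, Cmod_R in K1.
    rewrite <- Cmult_assoc. apply K1.
    apply (Rmult_lt_compat_r (Cmod e + 1)) in Hh; [|lra].
    replace (d1 / (Cmod e + 1) * (Cmod e + 1)) with d1 in Hh by (field; lra).
    pose proof (Rabs_pos h). nra. }
  split; apply small_o_derivative with (Cmod e); try apply Cmod_ge_0;
    intros eps He; destruct (Hs eps He) as [d1 [H1 K1]]; exists d1;
    (split; [exact H1|]); intros h Hh; specialize (K1 h Hh).
  - eapply Rle_trans; [|exact K1]. eapply Rle_trans; [|apply re_le_Cmod].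
    unfold Cminus. rewrite !re_plus, !re_opp, re_scal_r. apply Req_le.
    f_equal; ring.
  - eapply Rle_trans; [|exact K1]. eapply Rle_trans; [|apply Im_le_Cmod].
    unfold Cminus. rewrite !im_plus, !im_opp, im_scal_r. apply Req_le.
    f_equal; ring.
Qed.

(** At the maximum [g1 0 = 0]; if [d] were positive, [g1] would be positive just to the right of [0]
    and the mean value theorem would give a value above [g 0]. *)
Lemma second_derivative_at_max (g g1 : R -> R) (d delta : R) :
  0 < delta ->
  (forall t, Rabs t < delta -> is_derive g t (g1 t)) ->
  is_derive g1 0 d ->
  (forall t, Rabs t < delta -> g t <= g 0) -> d <= 0.
Proof.
  intros Hdl Hg Hg1 Hmax. apply Rnot_lt_le. intros Hd.
  assert (Z : g1 0 = 0).
  { assert (D0 : derivable_pt_lim g 0 (g1 0)).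
    { apply is_derive_Reals, Hg. rewrite Rabs_R0. exact Hdl. }
    set (pr := exist _ (g1 0) D0 : derivable_pt g 0).
    change (g1 0) with (derive_pt g 0 pr).
    apply (deriv_maximum g (- delta) delta 0 pr); try lra.
    intros x H1 H2. apply Hmax. apply Rabs_lt_between. lra. }
  apply is_derive_Reals in Hg1. destruct (Hg1 d Hd) as [eta Heta].
  set (t := Rmin eta delta / 2).
  assert (Ht : 0 < t).
  { apply Rdiv_lt_0_compat; [|lra]. apply Rmin_pos; [apply cond_pos|exact Hdl]. }
  assert (t < eta /\ t < delta) as [Ht1 Ht2].
  { pose proof (Rmin_l eta delta). pose proof (Rmin_r eta delta).
    unfold t in *. lra. }
  assert (Hpos : forall s, 0 < s <= t -> 0 < g1 s).
  { intros s Hs. specialize (Heta s ltac:(lra)).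
    rewrite Rabs_pos_eq in Heta by lra. specialize (Heta ltac:(lra)).
    rewrite Z, Rplus_0_l in Heta. apply Rabs_lt_between in Heta.
    assert (0 < (g1 s - 0) / s) by lra.
    apply (Rmult_lt_compat_r s) in H; [|lra].
    replace ((g1 s - 0) / s * s) with (g1 s) in H by (field; lra). lra. }
  destruct (MVT_cor2 g g1 0 t Ht) as [s [E Hs]].
  { intros x Hx. apply is_derive_Reals, Hg, Rabs_lt_between. lra. }
  specialize (Hmax t ltac:(apply Rabs_lt_between; lra)).
  specialize (Hpos s ltac:(lra)). nra.
Qed.

(** What the second derivative test consumes at a single point: a derivative in a neighbourhood, a
    second derivative at [z] alone. *)
Definition twice (f : C -> C) (z : C) : Prop :=
  exists f1 : C -> C, cnear z (fun y => cder f y (f1 y)) /\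
    exists f2 : C, cder f1 z f2.

(** The second derivative test for [|u|^2 + eps |z|^2] along a line: [X], [Y] are the parts of [u],
    and [a + t al], [b + t be] those of the moving point. The conclusion is half of the second
    derivative at [0]. *)
Lemma sum_squares_at_max (X X1 Y Y1 : R -> R) (X2 Y2 eps a b al be delta : R) :
  0 < delta ->
  (forall t, Rabs t < delta -> is_derive X t (X1 t)) ->
  (forall t, Rabs t < delta -> is_derive Y t (Y1 t)) ->
  is_derive X1 0 X2 -> is_derive Y1 0 Y2 ->
  (forall t, Rabs t < delta ->
     X t ^ 2 + Y t ^ 2 + eps * ((a + t * al) ^ 2 + (b + t * be) ^ 2)
     <= X 0 ^ 2 + Y 0 ^ 2 + eps * ((a + 0 * al) ^ 2 + (b + 0 * be) ^ 2)) ->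
  X1 0 ^ 2 + X 0 * X2 + Y1 0 ^ 2 + Y 0 * Y2 + eps * (al ^ 2 + be ^ 2) <= 0.
Proof.
  intros Hd HX HY HX1 HY1 Hmax.
  assert (H0 : Rabs 0 < delta) by (rewrite Rabs_R0; exact Hd).
  apply (Rmult_le_reg_l 2); [lra|]. rewrite Rmult_0_r.
  refine (second_derivative_at_max
    (fun t => X t ^ 2 + Y t ^ 2 + eps * ((a + t * al) ^ 2 + (b + t * be) ^ 2))
    (fun t => 2 * (X t * X1 t + Y t * Y1 t
        + eps * ((a + t * al) * al + (b + t * be) * be)))
    _ delta Hd _ _ Hmax).
  - intros t Ht. specialize (HX t Ht). specialize (HY t Ht).
    auto_derive.
    + repeat split; eexists; eassumption.
    + replace (Derive (fun x : R => X x) t) with (X1 t)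
        by (symmetry; apply is_derive_unique, HX).
      replace (Derive (fun x : R => Y x) t) with (Y1 t)
        by (symmetry; apply is_derive_unique, HY). ring.
  - specialize (HX 0 H0). specialize (HY 0 H0).
    auto_derive.
    + repeat split; eexists; eassumption.
    + replace (Derive (fun x : R => X x) 0) with (X1 0)
        by (symmetry; apply is_derive_unique, HX).
      replace (Derive (fun x : R => Y x) 0) with (Y1 0)
        by (symmetry; apply is_derive_unique, HY).
      replace (Derive (fun x : R => X1 x) 0) with X2
        by (symmetry; apply is_derive_unique, HX1).
      replace (Derive (fun x : R => Y1 x) 0) with Y2
        by (symmetry; apply is_derive_unique, HY1). ring.
Qed.

(** Adding the inequalities in the directions [1] and [i] cancels the second
    derivative of [u] and leaves the Laplacian [4 |u'|^2 + 4 eps > 0]. *)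
Lemma no_interior_max (u : C -> C) (z : C) (eps : R) :
  0 < eps -> twice u z ->
  ~ cnear z (fun y => Cmod (u y) ^ 2 + eps * Cmod y ^ 2
                      <= Cmod (u z) ^ 2 + eps * Cmod z ^ 2).
Proof.
  intros He (u1 & N1 & u2 & D2) Hmax.
  destruct (cnear_and _ _ _ N1 Hmax) as [dl [Hdl K]]. clear N1 Hmax.
  assert (Hdir : forall e : C, Cmod e = 1 ->
     Re (u1 z * e) ^ 2 + Re (u z) * Re (u2 * e * e)
     + Im (u1 z * e) ^ 2 + Im (u z) * Im (u2 * e * e)
     + eps * (Re e ^ 2 + Im e ^ 2) <= 0).
  { intros e Hm.
    assert (Hy : forall t : R, Rabs t < dl -> Cmod ((z + t * e) - z) < dl).
    { intros t Ht. replace ((z + t * e) - z)%C with (t * e)%C by ring.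
      rewrite Cmod_mult, Cmod_R, Hm. lra. }
    assert (Z0 : (z + 0%R * e)%C = z) by ring.
    assert (D1 : cder (fun y => u1 y * e)%C (z + 0%R * e)%C (u2 * e)%C).
    { rewrite Z0.
      apply cder_ext with (fun y => e * u1 y)%C; [intros; ring|].
      eapply cder_eq; [apply cder_scal, D2|ring]. }
    destruct (line_derivative _ _ _ _ _ D1) as [DX1 DY1].
    pose proof (sum_squares_at_max
      (fun t => Re (u (z + t * e)%C)) (fun t => Re (u1 (z + t * e)%C * e))
      (fun t => Im (u (z + t * e)%C)) (fun t => Im (u1 (z + t * e)%C * e))
      (Re (u2 * e * e)) (Im (u2 * e * e)) eps (Re z) (Im z) (Re e) (Im e) dl Hdl)
      as S.
    cbv beta in S. rewrite Z0 in S.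
    apply S; clear S.
    - intros t Ht. apply line_derivative, K, Hy, Ht.
    - intros t Ht. apply line_derivative, K, Hy, Ht.
    - exact DX1.
    - exact DY1.
    - intros t Ht. destruct (K _ (Hy t Ht)) as [_ M].
      rewrite !Cmod2_alt in M.
      rewrite re_plus, im_plus, re_scal_l, im_scal_l in M. lra. }
  pose proof (Hdir 1%C Cmod_1) as M1. pose proof (Hdir Ci Cmod_Ci) as M2.
  rewrite !Cmult_1_r in M1.
  replace (u2 * Ci * Ci)%C with (- u2)%C in M2
    by (apply injective_projections; simpl; ring).
  rewrite re_opp, im_opp in M2.
  replace (Re 1) with 1 in M1 by reflexivity.
  replace (Im 1) with 0 in M1 by reflexivity.
  pose proof (pow2_ge_0 (Re (u1 z))). pose proof (pow2_ge_0 (Im (u1 z))).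
  pose proof (pow2_ge_0 (Re (u1 z * Ci))).
  pose proof (pow2_ge_0 (Im (u1 z * Ci))).
  pose proof (pow2_ge_0 (Re Ci)). pose proof (pow2_ge_0 (Im Ci)).
  nra.
Qed.

Lemma Cmod_rcont (f : C -> C) (z : C) :
  ccont f z -> rcont (fun y => Cmod (f y)) z.
Proof.
  intros H eps He. destruct (H eps He) as [d [Hd K]]. exists d.
  split; [exact Hd|]. intros y Hy. eapply Rle_lt_trans; [|exact (K y Hy)].
  apply Rabs_le_between.
  pose proof (Cmod_sub_lower (f y) (f z)).
  pose proof (Cmod_sub_lower (f z) (f y)). rewrite Cmod_sub_sym in H1. lra.
Qed.

Lemma rcont_comp (g : C -> R) (h : R -> R) (z : C) :
  continuity_pt h (g z) -> rcont g z -> rcont (fun y => h (g y)) z.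
Proof.
  intros Hh Hg eps He. destruct (Hh eps He) as [a [Ha K]].
  destruct (Hg a Ha) as [d [Hd L]]. exists d. split; [exact Hd|].
  intros y Hy. destruct (Req_dec (g y) (g z)) as [->|Hn].
  - rewrite Rminus_diag, Rabs_R0. exact He.
  - apply (K (g y)). split; [split; [exact I|auto]|]. exact (L y Hy).
Qed.

Lemma rcont_plus (g h : C -> R) (z : C) :
  rcont g z -> rcont h z -> rcont (fun y => g y + h y) z.
Proof.
  intros Hg Hh eps He. destruct (Hg (eps / 2)) as [d1 [H1 K1]]; [lra|].
  destruct (Hh (eps / 2)) as [d2 [H2 K2]]; [lra|].
  exists (Rmin d1 d2). split; [apply Rmin_pos; assumption|]. intros y Hy.
  specialize (K1 y ltac:(eapply Rlt_le_trans; [exact Hy|apply Rmin_l])).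
  specialize (K2 y ltac:(eapply Rlt_le_trans; [exact Hy|apply Rmin_r])).
  replace (g y + h y - (g z + h z)) with ((g y - g z) + (h y - h z)) by ring.
  eapply Rle_lt_trans; [apply Rabs_triang|]. lra.
Qed.

Lemma ccont_id (z : C) : ccont (fun y => y) z.
Proof. exact (cder_ccont _ _ _ (cder_id z)). Qed.

Lemma closed_disc_complement (r : R) (z : C) :
  ~ Cmod z <= r -> cnear z (fun y => ~ Cmod y <= r).
Proof.
  intros H. exists (Cmod z - r). split; [lra|]. intros y Hy.
  pose proof (Cmod_sub_lower z y). rewrite Cmod_sub_sym in H0. lra.
Qed.

(** A maximum of the perturbed square that exceeds the boundary values cannot sit at a zero of [u],
    so second derivatives are required only where [u] does not vanish. The Schwarz lemma needs this
    exemption at the origin. *)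
Lemma max_principle (u : C -> C) (r M : R) :
  0 <= M ->
  (forall z, Cmod z <= r -> ccont u z) ->
  (forall z, Cmod z < r -> u z <> 0%C -> twice u z) ->
  (forall z, Cmod z = r -> Cmod (u z) <= M) ->
  forall z, Cmod z <= r -> Cmod (u z) <= M.
Proof.
  intros HM Hc H2 Hb a Ha. apply Rnot_lt_le. intros Hlt.
  (* Small enough that [M^2 + eps r^2 < |u a|^2]: the perturbation cannot move the maximum to the
     boundary. *)
  set (eps := (Cmod (u a) ^ 2 - M ^ 2) / (2 * (r ^ 2 + 1))).
  assert (Hr : 0 < 2 * (r ^ 2 + 1)) by nra.
  assert (He : 0 < eps) by (apply Rdiv_lt_0_compat; nra).
  assert (Her : M ^ 2 + eps * r ^ 2 < Cmod (u a) ^ 2).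
  { assert (eps * (2 * (r ^ 2 + 1)) = Cmod (u a) ^ 2 - M ^ 2)
      by (unfold eps; field; lra). nra. }
  destruct (compact_max (fun z => Cmod z <= r) r
     (fun z => Cmod (u z) ^ 2 + eps * Cmod z ^ 2) a) as [z [Kz Hz]].
  - auto.
  - apply closed_disc_complement.
  - intros z Hz. apply rcont_plus.
    + apply (rcont_comp (fun y => Cmod (u y)) (fun x => x ^ 2)).
      * apply derivable_continuous_pt, derivable_pt_pow.
      * apply Cmod_rcont, Hc, Hz.
    + apply (rcont_comp (fun y => Cmod y) (fun x => eps * x ^ 2)).
      * apply continuity_pt_scal, derivable_continuous_pt, derivable_pt_pow.
      * apply (Cmod_rcont (fun y => y)), ccont_id.
  - exact Ha.
  - pose proof (Hz a Ha) as Hza. cbv beta in Hza, Hz.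
    pose proof (Cmod_ge_0 a). pose proof (Cmod_ge_0 z).
    pose proof (Cmod_ge_0 (u z)).
    assert (Cmod z ^ 2 <= r ^ 2) by (apply pow_incr; lra).
    assert (0 <= eps * Cmod a ^ 2)
      by (apply Rmult_le_pos; [lra|apply pow2_ge_0]).
    assert (eps * Cmod z ^ 2 <= eps * r ^ 2)
      by (apply Rmult_le_compat_l; lra).
    assert (Hin : Cmod z < r).
    { destruct Kz as [Kz|Kz]; [exact Kz|]. exfalso.
      specialize (Hb z Kz).
      assert (Cmod (u z) ^ 2 <= M ^ 2) by (apply pow_incr; lra). lra. }
    assert (Hne : u z <> 0%C).
    { intros E. rewrite E, Cmod_0 in Hza. pose proof (pow2_ge_0 M). lra. }
    apply (no_interior_max u z eps He (H2 z Hin Hne)).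
    apply (cnear_imp _ (fun y => Cmod y < r)); [|apply cnear_lt, Hin].
    intros y Hy. apply Hz. lra.
Qed.

(** * Closure properties of twice differentiability *)

Lemma twice_id (z : C) : twice (fun y => y) z.
Proof.
  exists (fun _ => 1%C). split.
  - exists 1. split; [lra|]. intros y _. apply cder_id.
  - exists 0%C. apply cder_const.
Qed.

Lemma twice_const (k z : C) : twice (fun _ => k) z.
Proof.
  exists (fun _ => 0%C). split.
  - exists 1. split; [lra|]. intros y _. apply cder_const.
  - exists 0%C. apply cder_const.
Qed.

Lemma twice_mult (f g : C -> C) (z : C) :
  twice f z -> twice g z -> twice (fun y => f y * g y)%C z.
Proof.
  intros (f1 & Nf & f2 & Df) (g1 & Ng & g2 & Dg).
  exists (fun y => f1 y * g y + f y * g1 y)%C. split.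
  - apply (cnear_imp _ _ _ (fun y H => cder_mult f g y _ _ (proj1 H) (proj2 H))).
    apply cnear_and; assumption.
  - pose proof (cnear_at _ _ Nf) as Df0. pose proof (cnear_at _ _ Ng) as Dg0.
    cbv beta in Df0, Dg0.
    eexists. apply cder_plus; apply cder_mult; eassumption.
Qed.

Lemma ccont_neq0 (f : C -> C) (z : C) :
  ccont f z -> f z <> 0%C -> cnear z (fun y => f y <> 0%C).
Proof.
  intros H Hz. assert (Hp : 0 < Cmod (f z)) by (apply Cmod_gt_0, Hz).
  apply (cnear_imp _ (fun y => Cmod (f y - f z) < Cmod (f z)));
    [|exact (H _ Hp)].
  intros y Hy E. rewrite E in Hy.
  replace (0 - f z)%C with (- f z)%C in Hy by ring. rewrite Cmod_opp in Hy. lra.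
Qed.

Lemma twice_inv (f : C -> C) (z : C) :
  f z <> 0%C -> twice f z -> twice (fun y => / f y)%C z.
Proof.
  intros Hz (f1 & Nf & f2 & Df).
  pose proof (cnear_at _ _ Nf) as D1. cbv beta in D1.
  exists (fun y => - f1 y / (f y * f y))%C. split.
  - apply (cnear_imp _ _ _ (fun y H => cder_inv f y _ (proj1 H) (proj2 H))).
    apply cnear_and; [|exact Nf]. apply ccont_neq0; [|exact Hz].
    exact (cder_ccont _ _ _ D1).
  - eexists. apply cder_div.
    + apply Cmult_neq_0; exact Hz.
    + apply cder_opp, Df.
    + apply cder_mult; exact D1.
Qed.

Lemma twice_pow (f : C -> C) (n : nat) (z : C) :
  twice f z -> twice (fun y => f y ^ n)%C z.
Proof.
  intros H. induction n as [|n IH]; simpl; [apply twice_const|].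
  apply twice_mult; assumption.
Qed.

(** This is the passage to the limit of large exponents: if [a > b > 0], the powers of [a / b] would
    outgrow [m / k]. *)
Lemma pow_ratio_bound (a b k m : R) :
  0 <= b -> 0 < k -> (forall n, k * a ^ S n <= m * b ^ S n) -> a <= b.
Proof.
  intros Hb Hk H. apply Rnot_lt_le. intros Hlt.
  destruct Hb as [Hb|<-].
  - destruct (Pow_x_infinity (a / b)) with (b := m / k + 1) as [N HN].
    { rewrite Rabs_pos_eq; [|apply Rlt_le, Rdiv_lt_0_compat; lra].
      apply Rlt_gt, (Rmult_lt_reg_r b); [exact Hb|].
      unfold Rdiv. rewrite Rmult_assoc, Rinv_l; lra. }
    specialize (HN (S N) ltac:(auto)). specialize (H N).
    rewrite Rabs_pos_eq in HN
      by (apply pow_le, Rlt_le, Rdiv_lt_0_compat; lra).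
    unfold Rdiv in HN at 1. rewrite Rpow_mult_distr, pow_inv in HN.
    assert (Hp : 0 < b ^ S N) by (apply pow_lt, Hb).
    apply Rge_le in HN. apply (Rmult_le_compat_r (b ^ S N)) in HN; [|lra].
    rewrite Rmult_assoc, Rinv_l, Rmult_1_r in HN by lra.
    apply (Rmult_le_compat_l k) in HN; [|lra].
    replace (k * ((m / k + 1) * b ^ S N)) with ((m + k) * b ^ S N) in HN
      by (field; lra).
    nra.
  - specialize (H 0%nat). simpl in H. nra.
Qed.

(** * The lemmas of Schwarz and Jack *)

(** The maximum principle for [f ^ (n+1) / z ^ n], which vanishes at the origin,
    needs no differentiability there; [n] tending to infinity gives the Schwarz
    lemma for [f / z]. *)
Lemma schwarz (f : C -> C) (r T : R) :
  0 < r -> f 0%C = 0%C ->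
  (forall z, Cmod z <= r -> exists d, cder f z d) ->
  (forall z : C, z <> 0%C -> Cmod z < r -> twice f z) ->
  (forall z, Cmod z = r -> Cmod (f z) <= T) ->
  forall z, Cmod z <= r -> Cmod (f z) <= T * (Cmod z / r).
Proof.
  intros Hr F0 FD F2 FT z Hz.
  assert (HT : 0 <= T).
  { eapply Rle_trans; [apply Cmod_ge_0|apply (FT (RtoC r))].
    rewrite Cmod_R. apply Rabs_pos_eq. lra. }
  destruct (Ceq_dec z 0) as [->|Hz0].
  { rewrite F0, Cmod_0. unfold Rdiv. rewrite Rmult_0_l, Rmult_0_r. lra. }
  assert (Zp : 0 < Cmod z) by (apply Cmod_gt_0, Hz0).
  assert (Hn : forall n,
     Cmod (f z) * (Cmod (f z) / Cmod z) ^ n <= T * (T / r) ^ n).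
  { intros n. set (u := fun y => (f y * (f y * / y) ^ n)%C).
    assert (Hu : forall y : C, y <> 0%C ->
       Cmod (u y) = Cmod (f y) * (Cmod (f y) / Cmod y) ^ n).
    { intros y Hy. unfold u. rewrite Cmod_mult, Cmod_pow, Cmod_mult, Cmod_inv
        by exact Hy. reflexivity. }
    assert (Htw : forall y : C, y <> 0%C -> Cmod y < r -> twice u y).
    { intros y Hy Hyr. apply twice_mult; [apply F2; assumption|].
      apply twice_pow, twice_mult; [apply F2; assumption|].
      apply twice_inv; [exact Hy|apply twice_id]. }
    assert (U0 : u 0%C = 0%C) by (unfold u; rewrite F0; ring).
    rewrite <- Hu by exact Hz0.
    apply (max_principle u r); try exact Hz.
    - apply Rmult_le_pos; [exact HT|]. apply pow_le.
      apply Rmult_le_pos; [exact HT|]. apply Rlt_le, Rinv_0_lt_compat, Hr.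
    - intros y Hyr. destruct (Ceq_dec y 0) as [->|Hy].
      + destruct (FD 0%C Hyr) as [d D].
        destruct (D 1 Rlt_0_1) as [d1 [H1 K1]].
        (* Differentiability at the origin bounds [|f y / y|] by [K] nearby, so
           [|u y| <= |f y| * K ^ n], which tends to [0]. *)
        set (K := Cmod d + 1).
        assert (HK : 0 < K ^ n).
        { apply pow_lt. unfold K. pose proof (Cmod_ge_0 d). lra. }
        intros eps He. destruct (cder_ccont _ _ _ D (eps / K ^ n)) as [d2 [H2 K2]].
        { apply Rdiv_lt_0_compat; assumption. }
        exists (Rmin d1 d2). split; [apply Rmin_pos; assumption|].
        intros y Hy.
        specialize (K1 y ltac:(eapply Rlt_le_trans; [exact Hy|apply Rmin_l])).
        specialize (K2 y ltac:(eapply Rlt_le_trans; [exact Hy|apply Rmin_r])).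
        rewrite F0 in K1, K2. rewrite U0.
        replace (u y - 0)%C with (u y) by ring.
        replace (f y - 0)%C with (f y) in K2 by ring.
        replace (f y - 0 - d * (y - 0))%C with (f y - d * y)%C in K1 by ring.
        replace (y - 0)%C with y in K1 by ring.
        destruct (Ceq_dec y 0) as [->|Hy0].
        { rewrite U0, Cmod_0. exact He. }
        assert (Yp : 0 < Cmod y) by (apply Cmod_gt_0, Hy0).
        rewrite Hu by exact Hy0.
        assert (Hq : Cmod (f y) / Cmod y <= K).
        { apply (Rmult_le_reg_r (Cmod y)); [exact Yp|].
          unfold Rdiv. rewrite Rmult_assoc, Rinv_l, Rmult_1_r by lra.
          pose proof (Cmod_triangle (f y - d * y) (d * y)).
          replace (f y - d * y + d * y)%C with (f y) in H by ring.
          rewrite Cmod_mult in H. unfold K. lra. }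
        assert (Hqn : (Cmod (f y) / Cmod y) ^ n <= K ^ n).
        { apply pow_incr. split; [|exact Hq].
          apply Rmult_le_pos; [apply Cmod_ge_0|].
          apply Rlt_le, Rinv_0_lt_compat, Yp. }
        apply Rle_lt_trans with (Cmod (f y) * K ^ n).
        { apply Rmult_le_compat_l; [apply Cmod_ge_0|exact Hqn]. }
        apply (Rmult_lt_compat_r (K ^ n)) in K2; [|exact HK].
        replace (eps / K ^ n * K ^ n) with eps in K2 by (field; lra). exact K2.
      + destruct (FD y Hyr) as [d D].
        assert (Dq : exists e, cder (fun x => f x * / x)%C y e).
        { eexists. apply cder_mult; [exact D|].
          apply (cder_inv (fun x => x)); [exact Hy|apply cder_id]. }
        destruct Dq as [e Dq].
        assert (Dn : exists e, cder (fun x => (f x * / x) ^ n)%C y e).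
        { clear - Dq. induction n as [|n [e' IH]]; simpl;
            eexists; [apply cder_const|apply cder_mult; eassumption]. }
        destruct Dn as [e' Dn].
        eapply cder_ccont. apply cder_mult; eassumption.
    - intros y Hyr Hy. apply Htw; [|exact Hyr].
      intros E. rewrite E in Hy. exact (Hy U0).
    - intros y Hyr. assert (Hy : y <> 0%C) by (apply Cmod_gt_0; lra).
      rewrite Hu, Hyr by exact Hy. specialize (FT y Hyr).
      apply Rmult_le_compat; try apply Cmod_ge_0; [|exact FT|].
      + apply pow_le, Rmult_le_pos; [apply Cmod_ge_0|].
        apply Rlt_le, Rinv_0_lt_compat, Hr.
      + apply pow_incr. split.
        * apply Rmult_le_pos; [apply Cmod_ge_0|].
          apply Rlt_le, Rinv_0_lt_compat, Hr.
        * apply Rmult_le_compat_r; [|exact FT].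
          apply Rlt_le, Rinv_0_lt_compat, Hr. }
  assert (Q : Cmod (f z) / Cmod z <= T / r).
  { apply (pow_ratio_bound _ _ (Cmod z) r); [|exact Zp|].
    - apply Rmult_le_pos; [exact HT|]. apply Rlt_le, Rinv_0_lt_compat, Hr.
    - intros n. simpl. specialize (Hn n).
      replace (Cmod z * (Cmod (f z) / Cmod z * (Cmod (f z) / Cmod z) ^ n))
        with (Cmod (f z) * (Cmod (f z) / Cmod z) ^ n) by (field; lra).
      replace (r * (T / r * (T / r) ^ n)) with (T * (T / r) ^ n)
        by (field; lra). exact Hn. }
  apply (Rmult_le_compat_r (Cmod z)) in Q; [|lra].
  replace (Cmod (f z) / Cmod z * Cmod z) with (Cmod (f z)) in Q by (field; lra).
  replace (T * (Cmod z / r)) with (T / r * Cmod z) by (field; lra). exact Q.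
Qed.

Lemma right_derivative_nonpos (g : R -> R) (d delta : R) :
  0 < delta -> is_derive g 0 d -> g 0 = 0 ->
  (forall t, 0 < t < delta -> g t <= 0) -> d <= 0.
Proof.
  intros Hdl Hg G0 H. apply Rnot_lt_le. intros Hd.
  apply is_derive_Reals in Hg. destruct (Hg d Hd) as [eta Heta].
  set (t := Rmin eta delta / 2).
  assert (Ht : 0 < t).
  { apply Rdiv_lt_0_compat; [|lra]. apply Rmin_pos; [apply cond_pos|exact Hdl]. }
  assert (t < eta /\ t < delta) as [Ht1 Ht2].
  { pose proof (Rmin_l eta delta). pose proof (Rmin_r eta delta).
    unfold t in *. lra. }
  specialize (Heta t ltac:(lra)). rewrite Rabs_pos_eq in Heta by lra.
  specialize (Heta Ht1). rewrite Rplus_0_l, G0 in Heta.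
  apply Rabs_lt_between in Heta. specialize (H t ltac:(lra)).
  assert (Hq : 0 < (g t - 0) / t) by lra.
  apply (Rmult_lt_compat_r t) in Hq; [|lra].
  replace ((g t - 0) / t * t) with (g t) in Hq by (field; lra). lra.
Qed.

(** At a point of [|z| = r] where [|f|] is maximal on the disc, moving inwards
    in the directions [z (-1 + i s)] shows that [conj f * z f' - |f|^2] is real
    and nonnegative. *)
Lemma jack_lemma (f : C -> C) (z d : C) (r : R) :
  0 < r -> Cmod z = r -> cder f z d -> f z <> 0%C ->
  (forall y, Cmod y <= r -> Cmod (f y) <= Cmod (f z) * (Cmod y / r)) ->
  exists k : R, 1 <= k /\ (z * d)%C = (k * f z)%C.
Proof.
  intros Hr Hz D Fz HS. set (T := Cmod (f z)) in *.
  assert (HT : 0 < T) by (apply Cmod_gt_0, Fz).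
  set (L := (Cconj (f z) * (z * d))%C).
  assert (Hdir : forall s : R, - (Re L - T ^ 2) - s * Im L <= 0).
  { intros s. set (e := (z * (-1, s))%C).
    assert (D0 : cder f (z + 0%R * e)%C d).
    { replace (z + 0%R * e)%C with z by ring. exact D. }
    destruct (line_derivative _ _ _ _ _ D0) as [DX DY].
    assert (E0 : (z + 0%R * e)%C = z) by ring.
    assert (DG : is_derive (fun t : R => Re (f (z + t * e)%C) ^ 2
         + Im (f (z + t * e)%C) ^ 2 - T ^ 2 * ((1 - t) ^ 2 + (t * s) ^ 2)) 0
         (2 * (- (Re L - T ^ 2) - s * Im L))).
    { assert (Hgen : forall (X Y : R -> R) (X1 Y1 : R),
        is_derive X 0 X1 -> is_derive Y 0 Y1 ->
        is_derive (fun t : R => X t ^ 2 + Y t ^ 2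
            - T ^ 2 * ((1 - t) ^ 2 + (t * s) ^ 2)) 0
          (2 * X 0 * X1 + 2 * Y 0 * Y1 + 2 * T ^ 2)).
      { intros X Y X1 Y1 HX HY. auto_derive.
        - repeat split; eexists; eassumption.
        - replace (Derive (fun x : R => X x) 0) with X1
            by (symmetry; apply is_derive_unique, HX).
          replace (Derive (fun x : R => Y x) 0) with Y1
            by (symmetry; apply is_derive_unique, HY). ring. }
      replace (2 * (- (Re L - T ^ 2) - s * Im L))
        with (2 * Re (f (z + 0%R * e)%C) * Re (d * e)
          + 2 * Im (f (z + 0%R * e)%C) * Im (d * e) + 2 * T ^ 2)
        by (rewrite E0; unfold L, e, Re, Im; simpl; ring).
      exact (Hgen _ _ _ _ DX DY). }
    cut (2 * (- (Re L - T ^ 2) - s * Im L) <= 0); [lra|].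
    (* The moving point has modulus [r |1 - t + i t s|], and [(1 - t)^2 + (t s)^2 <= 1] exactly when
       [t (1 + s^2) <= 2], for [t > 0]. *)
    apply (right_derivative_nonpos _ _ (2 / (1 + s ^ 2)) ltac:(
      apply Rdiv_lt_0_compat; nra) DG).
    - rewrite E0, <- Cmod2_alt. unfold T. ring.
    - intros t Ht. rewrite <- Cmod2_alt.
      assert (M : Cmod (z + t * e) ^ 2 = r ^ 2 * ((1 - t) ^ 2 + (t * s) ^ 2)).
      { replace (z + t * e)%C with (z * (1 - t, t * s)%R)%C.
        - rewrite Cmod_mult, Hz, Rpow_mult_distr, Cmod2_alt. reflexivity.
        - unfold e. apply injective_projections; simpl; ring. }
      assert (Hq : (1 - t) ^ 2 + (t * s) ^ 2 <= 1).
      { assert (t * (1 + s ^ 2) < 2).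
        { destruct Ht as [_ Ht]. apply (Rmult_lt_compat_r (1 + s ^ 2)) in Ht; [|nra].
          replace (2 / (1 + s ^ 2) * (1 + s ^ 2)) with 2 in Ht by (field; nra).
          exact Ht. }
        nra. }
      assert (My : Cmod (z + t * e) <= r).
      { pose proof (Cmod_ge_0 (z + t * e)). nra. }
      specialize (HS _ My).
      assert (P : Cmod (f (z + t * e)%C) ^ 2 <= (T * (Cmod (z + t * e) / r)) ^ 2).
      { apply pow_incr. split; [apply Cmod_ge_0|exact HS]. }
      replace ((T * (Cmod (z + t * e) / r)) ^ 2)
        with (T ^ 2 * (Cmod (z + t * e) ^ 2 / r ^ 2)) in P by (field; lra).
      rewrite M in P.
      replace (r ^ 2 * ((1 - t) ^ 2 + (t * s) ^ 2) / r ^ 2)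
        with ((1 - t) ^ 2 + (t * s) ^ 2) in P by (field; lra). lra. }
  assert (LI : Im L = 0).
  { destruct (Req_dec (Im L) 0) as [H|H]; [exact H|exfalso].
    (* An affine function of [s] bounded above is constant: for this slope the left side of [Hdir]
       would be [1]. *)
    specialize (Hdir (- (Re L - T ^ 2 + 1) / Im L)).
    replace (- (Re L - T ^ 2 + 1) / Im L * Im L) with (- (Re L - T ^ 2 + 1))
      in Hdir by (field; exact H). lra. }
  assert (LR : T ^ 2 <= Re L).
  { specialize (Hdir 0). lra. }
  exists (Re L / T ^ 2). split.
  - apply (Rmult_le_reg_r (T ^ 2)); [nra|]. unfold Rdiv.
    rewrite Rmult_assoc, Rinv_l; nra.
  - assert (EL : L = RtoC (Re L)) by (apply injective_projections; [reflexivity|exact LI]).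
    assert (ET : (f z * Cconj (f z))%C = RtoC (T ^ 2))
      by (unfold T; rewrite Cmod2_conj; reflexivity).
    assert (HT2 : RtoC (T ^ 2) <> 0%C).
    { intros E. apply RtoC_inj in E. nra. }
    rewrite RtoC_div by nra. rewrite <- EL.
    replace (L / RtoC (T ^ 2) * f z)%C
      with (z * d * ((f z * Cconj (f z)) / RtoC (T ^ 2)))%C
      by (unfold L; field; exact HT2).
    rewrite ET. field. exact HT2.
Qed.

(** At a point of [|z| = r] where [|f|] is maximal, [z f' = k f] with [k >= 1]
    turns the equation into [k f = B w (1 - (k - 1) f)], which is impossible if
    [|f| >= |B|]. *)
Lemma jack_subordination (f f1 w : C -> C) (B r : R) :
  0 < Rabs B < 1 -> f 0%C = 0%C ->
  (forall z, Cmod z < r -> cder f z (f1 z)) ->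
  (forall z : C, z <> 0%C -> Cmod z < r -> twice f z) ->
  (forall z, Cmod z < r -> Cmod (w z) < 1) ->
  (forall z, Cmod z < r ->
     z * f1 z * (1 + B * w z) = (1 + f z) * (B * w z))%C ->
  forall z, Cmod z < r -> Cmod (f z) < Rabs B.
Proof.
  intros HB F0 FD F2 Hw Heq a Ha.
  set (q := (Cmod a + r) / 2).
  pose proof (Cmod_ge_0 a).
  assert (Hq : 0 < q) by (unfold q; lra).
  assert (Hqr : q < r) by (unfold q; lra).
  assert (Haq : Cmod a <= q) by (unfold q; lra).
  destruct (compact_max (fun z => Cmod z = q) q (fun z => Cmod (f z)) (RtoC q))
    as [z [Kz Hz]].
  { intros z ->. lra. }
  { intros z Hz. exists (Rabs (Cmod z - q)). split.
    - apply Rabs_pos_lt. lra.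
    - intros y Hy E. rewrite <- E in Hy.
      apply Rlt_not_le in Hy. apply Hy.
      pose proof (Cmod_sub_lower z y). pose proof (Cmod_sub_lower y z).
      rewrite Cmod_sub_sym in H0.
      apply Rabs_le_between. lra. }
  { intros z Hz. apply Cmod_rcont. eapply cder_ccont, FD. lra. }
  { rewrite Cmod_R. apply Rabs_pos_eq. lra. }
  assert (HS : forall y, Cmod y <= q ->
      Cmod (f y) <= Cmod (f z) * (Cmod y / q)).
  { apply schwarz; auto.
    - intros y Hy. exists (f1 y). apply FD. lra.
    - intros y Hy0 Hy. apply F2; [exact Hy0|lra]. }
  assert (HT : Cmod (f z) < Rabs B).
  { apply Rnot_le_lt. intros HT.
    assert (Fz : f z <> 0%C) by (apply Cmod_gt_0; lra).
    destruct (jack_lemma f z (f1 z) q Hq Kz (FD z ltac:(lra)) Fz HS)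
      as [k [Hk E]].
    specialize (Heq z ltac:(lra)). rewrite E in Heq.
    assert (E2 : (k * f z)%C = (B * w z * (1 - (k - 1)%R * f z))%C).
    { rewrite RtoC_minus.
      replace (k * f z)%C
        with (k * f z * (1 + B * w z) - B * w z * (k * f z))%C by ring.
      rewrite Heq. ring. }
    apply (f_equal Cmod) in E2. rewrite !Cmod_mult, !Cmod_R in E2.
    rewrite (Rabs_pos_eq k) in E2 by lra.
    assert (Hm : Cmod (1 - (k - 1)%R * f z) <= 1 + (k - 1) * Cmod (f z)).
    { unfold Cminus. eapply Rle_trans; [apply Cmod_triangle|].
      rewrite Cmod_opp, Cmod_mult, Cmod_1, Cmod_R, (Rabs_pos_eq (k - 1)) by lra.
      lra. }
    (* With [t = |f z|], [b = |B|] and [b <= t], the contradiction is the chain [k t <= b |w| (1 +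
       (k - 1) t) < b (1 + (k - 1) t) <= b + (k - 1) t <= k t]. *)
    specialize (Hw z ltac:(lra)). pose proof (Cmod_ge_0 (w z)).
    set (t := Cmod (f z)) in *. set (b := Rabs B) in *.
    assert (Hkt : 0 <= (k - 1) * t) by (apply Rmult_le_pos; lra).
    assert (H1 : b * Cmod (w z) * Cmod (1 - (k - 1)%R * f z)
        <= b * Cmod (w z) * (1 + (k - 1) * t)).
    { apply Rmult_le_compat_l; [apply Rmult_le_pos; lra|exact Hm]. }
    assert (H2 : b * Cmod (w z) * (1 + (k - 1) * t) < b * (1 + (k - 1) * t)).
    { apply Rmult_lt_compat_r; nra. }
    assert (b * ((k - 1) * t) <= (k - 1) * t) by nra.
    lra. }
  eapply Rle_lt_trans; [apply HS, Haq|].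
  assert (Cmod a / q <= 1).
  { apply (Rmult_le_reg_r q); [exact Hq|]. unfold Rdiv.
    rewrite Rmult_assoc, Rinv_l; lra. }
  pose proof (Cmod_ge_0 (f z)). nra.
Qed.

(** * Exponential and logarithm *)

Definition cexp (z : C) : C := (exp (Re z) * cos (Im z), exp (Re z) * sin (Im z)).

Lemma cexp_plus (z u : C) : cexp (z + u) = (cexp z * cexp u)%C.
Proof.
  unfold cexp. rewrite re_plus, im_plus, exp_plus, cos_plus, sin_plus.
  apply injective_projections; simpl; ring.
Qed.

Lemma cexp_0 : cexp 0 = 1%C.
Proof.
  unfold cexp. simpl. rewrite exp_0, cos_0, sin_0.
  apply injective_projections; simpl; ring.
Qed.

Lemma cexp_RtoC (x : R) : cexp x = exp x.
Proof.
  unfold cexp. simpl. rewrite cos_0, sin_0.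
  apply injective_projections; simpl; ring.
Qed.

Lemma Cmod_cexp (z : C) : Cmod (cexp z) = exp (Re z).
Proof.
  assert (H : 0 < exp (Re z)) by apply exp_pos.
  unfold Cmod, cexp. simpl fst. simpl snd.
  replace ((exp (Re z) * cos (Im z)) ^ 2 + (exp (Re z) * sin (Im z)) ^ 2)
    with (exp (Re z) ^ 2).
  - apply sqrt_pow2. lra.
  - pose proof (sin2_cos2 (Im z)) as E. unfold Rsqr in E.
    replace ((exp (Re z) * cos (Im z)) ^ 2 + (exp (Re z) * sin (Im z)) ^ 2)
      with (exp (Re z) ^ 2
        * (sin (Im z) * sin (Im z) + cos (Im z) * cos (Im z))) by ring.
    rewrite E. ring.
Qed.

Lemma is_derive_small_o (g : R -> R) (l eps : R) :
  is_derive g 0 l -> 0 < eps ->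
  exists delta, 0 < delta /\
    forall h, Rabs h < delta -> Rabs (g h - g 0 - l * h) <= eps * Rabs h.
Proof.
  intros D He. apply is_derive_Reals in D. destruct (D eps He) as [d Hd].
  exists d. split; [apply cond_pos|]. intros h Hh.
  destruct (Req_dec h 0) as [->|h0].
  - rewrite Rabs_R0. replace (g 0 - g 0 - l * 0) with 0 by ring.
    rewrite Rabs_R0. lra.
  - specialize (Hd h h0 Hh). rewrite Rplus_0_l in Hd.
    replace (g h - g 0 - l * h) with (((g h - g 0) / h - l) * h)
      by (field; exact h0).
    rewrite Rabs_mult. apply Rmult_le_compat_r; [apply Rabs_pos|lra].
Qed.

(** The addition formula reduces the claim to the origin, where it follows from the real derivatives
    of [exp], [sin] and [cos]. *)
Lemma cder_cexp (z : C) : cder cexp z (cexp z).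
Proof.
  assert (D0 : cder cexp 0 1).
  { intros eps He.
    assert (De : is_derive exp 0 1) by (rewrite <- exp_0; apply is_derive_exp).
    assert (Ds : is_derive sin 0 1) by (rewrite <- cos_0; apply is_derive_sin).
    assert (Dc : is_derive cos 0 0).
    { pose proof (is_derive_cos 0) as H. rewrite sin_0, Ropp_0 in H. exact H. }
    (* The three parts into which the remainder is split below cost [1/12], [4/12] and [2/12] of
       [eps * |y|]. *)
    destruct (is_derive_small_o _ _ (eps / 12) De ltac:(lra)) as [d1 [H1 K1]].
    destruct (is_derive_small_o _ _ (eps / 12) Ds ltac:(lra)) as [d2 [H2 K2]].
    destruct (is_derive_small_o _ _ (eps / 12) Dc ltac:(lra)) as [d3 [H3 K3]].
    destruct (is_derive_small_o _ _ 1 De ltac:(lra)) as [d4 [H4 K4]].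
    rewrite exp_0 in K1, K4. rewrite sin_0 in K2. rewrite cos_0 in K3.
    exists (Rmin (Rmin d1 (Rmin d2 d3)) (Rmin d4 (Rmin (1 / 2) (eps / 12)))).
    split.
    { repeat apply Rmin_pos; lra. }
    intros y. replace (y - 0)%C with y by ring. intros Hy.
    rewrite cexp_0.
    pose proof (re_le_Cmod y) as Ha. pose proof (Im_le_Cmod y) as Hb.
    set (a := Re y) in *. set (b := Im y) in *. set (m := Cmod y) in *.
    pose proof (Rmin_l (Rmin d1 (Rmin d2 d3)) (Rmin d4 (Rmin (1 / 2) (eps / 12)))).
    pose proof (Rmin_r (Rmin d1 (Rmin d2 d3)) (Rmin d4 (Rmin (1 / 2) (eps / 12)))).
    pose proof (Rmin_l d1 (Rmin d2 d3)). pose proof (Rmin_r d1 (Rmin d2 d3)).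
    pose proof (Rmin_l d2 d3). pose proof (Rmin_r d2 d3).
    pose proof (Rmin_l d4 (Rmin (1 / 2) (eps / 12))).
    pose proof (Rmin_r d4 (Rmin (1 / 2) (eps / 12))).
    pose proof (Rmin_l (1 / 2) (eps / 12)). pose proof (Rmin_r (1 / 2) (eps / 12)).
    specialize (K1 a ltac:(lra)). specialize (K2 b ltac:(lra)).
    specialize (K3 b ltac:(lra)). specialize (K4 a ltac:(lra)).
    assert (Hm0 : 0 <= m) by apply Cmod_ge_0.
    assert (Hea : Rabs (exp a - 1) <= 2 * m).
    { replace (exp a - 1) with ((exp a - 1 - 1 * a) + a) by ring.
      eapply Rle_trans; [apply Rabs_triang|]. lra. }
    assert (Hea2 : Rabs (exp a) <= 2).
    { rewrite Rabs_pos_eq by (apply Rlt_le, exp_pos).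
      apply Rabs_le_between in Hea. lra. }
    replace (cexp y - 1 - 1 * y)%C with
      (RtoC (exp a - 1 - 1 * a)
       + (RtoC (exp a) * (RtoC (cos b - 1 - 0 * b)
                          + Ci * RtoC (sin b - 0 - 1 * b))
          + Ci * RtoC ((exp a - 1) * b)))%C
      by (unfold cexp, a, b; apply injective_projections; simpl;
          unfold Re, Im; ring).
    eapply Rle_trans; [apply Cmod_triangle|].
    eapply Rle_trans; [apply Rplus_le_compat_l, Cmod_triangle|].
    rewrite !Cmod_mult, Cmod_Ci, Rmult_1_l.
    eapply Rle_trans.
    { apply Rplus_le_compat_l, Rplus_le_compat_r, Rmult_le_compat_l;
        [apply Cmod_ge_0|apply Cmod_triangle]. }
    rewrite Cmod_mult, Cmod_Ci, Rmult_1_l, !Cmod_R, Rabs_mult.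
    assert (P1 : Rabs (exp a) * (Rabs (cos b - 1 - 0 * b)
        + Rabs (sin b - 0 - 1 * b)) <= 2 * (eps / 12 * m + eps / 12 * m)).
    { apply Rmult_le_compat; try apply Rabs_pos; try lra.
      - apply Rplus_le_le_0_compat; apply Rabs_pos.
      - assert (eps / 12 * Rabs b <= eps / 12 * m)
          by (apply Rmult_le_compat_l; lra). lra. }
    assert (P2 : Rabs (exp a - 1) * Rabs b <= (2 * (eps / 12)) * m).
    { apply Rmult_le_compat; try apply Rabs_pos; lra. }
    assert (P3 : eps / 12 * Rabs a <= eps / 12 * m)
      by (apply Rmult_le_compat_l; lra).
    assert (P4 : 0 <= eps * m) by (apply Rmult_le_pos; lra).
    rewrite Rmult_1_l in K1. lra. }
  assert (D1 : cder (fun y => y - z)%C z 1%C).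
  { eapply cder_eq; [apply cder_minus; [apply cder_id|apply cder_const]|].
    ring. }
  apply cder_ext with (fun y => cexp z * cexp (y - z))%C.
  - intros y. rewrite <- cexp_plus. f_equal. ring.
  - eapply cder_eq.
    + apply cder_scal. apply (cder_comp cexp (fun y => y - z)%C); [|exact D1].
      replace (z - z)%C with (RtoC 0) by ring. exact D0.
    + ring.
Qed.

Lemma cexp_neq_0 (z : C) : cexp z <> 0%C.
Proof. apply Cmod_gt_0. rewrite Cmod_cexp. apply exp_pos. Qed.

(** The principal logarithm, but only on the right half-plane: elsewhere [atan (Im z / Re z)] is not
    the argument, hence the hypothesis [0 < Re z] in the lemmas on it. *)
Definition Clog (z : C) : C := (ln (Cmod z), atan (Im z / Re z)).

Lemma Re_pos_neq_0 (z : C) : 0 < Re z -> z <> 0%C.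
Proof. intros H E. rewrite E in H. simpl in H. lra. Qed.

Lemma cexp_Clog (z : C) : 0 < Re z -> cexp (Clog z) = z.
Proof.
  intros H. assert (Hm : 0 < Cmod z) by (apply Cmod_gt_0, Re_pos_neq_0, H).
  unfold cexp, Clog. simpl Re. simpl Im. rewrite exp_ln by exact Hm.
  rewrite cos_atan, sin_atan.
  assert (E : sqrt (1 + (Im z / Re z)²) = Cmod z / Re z).
  { rewrite <- (sqrt_pow2 (Cmod z / Re z)).
    - f_equal. unfold Rdiv. rewrite Rpow_mult_distr, Cmod2_alt.
      unfold Rsqr. field. lra.
    - apply Rlt_le, Rdiv_lt_0_compat; assumption. }
  rewrite E. destruct z as [x y]. simpl Re in *. simpl Im in *.
  apply injective_projections; simpl; field; lra.
Qed.

Lemma Re_rcont (f : C -> C) (z : C) : ccont f z -> rcont (fun y => Re (f y)) z.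
Proof.
  intros H eps He. destruct (H eps He) as [d [Hd K]]. exists d.
  split; [exact Hd|]. intros y Hy. eapply Rle_lt_trans; [|exact (K y Hy)].
  eapply Rle_trans; [|apply re_le_Cmod]. unfold Cminus.
  rewrite re_plus, re_opp. apply Rle_refl.
Qed.

Lemma Im_rcont (f : C -> C) (z : C) : ccont f z -> rcont (fun y => Im (f y)) z.
Proof.
  intros H eps He. destruct (H eps He) as [d [Hd K]]. exists d.
  split; [exact Hd|]. intros y Hy. eapply Rle_lt_trans; [|exact (K y Hy)].
  eapply Rle_trans; [|apply Im_le_Cmod]. unfold Cminus.
  rewrite im_plus, im_opp. apply Rle_refl.
Qed.

(** Polarisation, [4 g h = (g + h)^2 - (g - h)^2], reduces products to sums and squares. *)
Lemma rcont_mult (g h : C -> R) (z : C) :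
  rcont g z -> rcont h z -> rcont (fun y => g y * h y) z.
Proof.
  intros Hg Hh.
  assert (Hq : forall k, rcont k z -> rcont (fun y => k y ^ 2) z).
  { intros k Hk. apply (rcont_comp k (fun x => x ^ 2)); [|exact Hk].
    apply derivable_continuous_pt, derivable_pt_pow. }
  assert (Hl : forall a k, rcont k z -> rcont (fun y => a * k y) z).
  { intros a k Hk. apply (rcont_comp k (fun x => a * x)); [|exact Hk].
    apply continuity_pt_scal, continuity_pt_id. }
  assert (H : rcont (fun y => / 4 * (g y + h y) ^ 2
                              + - / 4 * (g y + -1 * h y) ^ 2) z).
  { apply rcont_plus; apply Hl, Hq, rcont_plus; auto. }
  intros eps He. destruct (H eps He) as [d [Hd K]]. exists d.
  split; [exact Hd|]. intros y Hy.
  replace (g y * h y - g z * h z) with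
    (/ 4 * (g y + h y) ^ 2 + - / 4 * (g y + -1 * h y) ^ 2 -
     (/ 4 * (g z + h z) ^ 2 + - / 4 * (g z + -1 * h z) ^ 2)) by field.
  apply K, Hy.
Qed.

Lemma ccont_parts (f : C -> C) (z : C) :
  rcont (fun y => Re (f y)) z -> rcont (fun y => Im (f y)) z -> ccont f z.
Proof.
  intros Hr Hi eps He. destruct (Hr (eps / 2)) as [d1 [H1 K1]]; [lra|].
  destruct (Hi (eps / 2)) as [d2 [H2 K2]]; [lra|].
  exists (Rmin d1 d2). split; [apply Rmin_pos; assumption|]. intros y Hy.
  specialize (K1 y ltac:(eapply Rlt_le_trans; [exact Hy|apply Rmin_l])).
  specialize (K2 y ltac:(eapply Rlt_le_trans; [exact Hy|apply Rmin_r])).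
  replace (f y - f z)%C with
    (RtoC (Re (f y) - Re (f z)) + Ci * RtoC (Im (f y) - Im (f z)))%C
    by (apply injective_projections; simpl; unfold Re, Im; ring).
  eapply Rle_lt_trans; [apply Cmod_triangle|].
  rewrite Cmod_mult, Cmod_Ci, !Cmod_R. lra.
Qed.

Lemma ccont_Clog (z : C) : 0 < Re z -> ccont Clog z.
Proof.
  intros H. apply ccont_parts; simpl.
  - apply (rcont_comp Cmod ln).
    + apply derivable_continuous_pt. exists (/ Cmod z).
      apply derivable_pt_lim_ln, Cmod_gt_0, Re_pos_neq_0, H.
    + apply (Cmod_rcont (fun y => y)), ccont_id.
  - apply (rcont_comp (fun y => Im y / Re y) atan).
    + apply derivable_continuous_pt, derivable_pt_atan.
    + apply (rcont_mult Im (fun y => / Re y)).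
      * apply (Im_rcont (fun y => y)), ccont_id.
      * apply (rcont_comp Re Rinv).
        -- apply (continuity_pt_inv (fun x => x)); [apply continuity_pt_id|lra].
        -- apply (Re_rcont (fun y => y)), ccont_id.
Qed.

Lemma cnear_Re_pos (z : C) : 0 < Re z -> cnear z (fun y => 0 < Re y).
Proof.
  intros H. destruct (Re_rcont (fun y => y) z (ccont_id z) (Re z) H) as [d [Hd K]].
  exists d. split; [exact Hd|]. intros y Hy. specialize (K y Hy).
  cbv beta in K. apply Rabs_lt_between in K. lra.
Qed.

Lemma cder_Clog (z : C) : 0 < Re z -> cder Clog z (/ z)%C.
Proof.
  intros H. eapply cder_eq.
  - apply (cder_inverse cexp Clog (fun y => y) z (cexp (Clog z)) 1%C).
    + apply (cnear_imp _ _ _ cexp_Clog), cnear_Re_pos, H.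
    + apply ccont_Clog, H.
    + apply cder_cexp.
    + apply cexp_neq_0.
    + apply cder_id.
  - rewrite cexp_Clog by exact H. field. apply Re_pos_neq_0, H.
Qed.

Lemma Clog_RtoC (x : R) : 0 < x -> Clog x = ln x.
Proof.
  intros H. unfold Clog. rewrite Cmod_R, Rabs_pos_eq by lra. simpl.
  unfold Rdiv. rewrite Rmult_0_l, atan_0. reflexivity.
Qed.

Lemma Clog_1 : Clog 1 = 0%C.
Proof. rewrite Clog_RtoC by lra. rewrite ln_1. reflexivity. Qed.

Lemma Re_one_plus_pos (v : C) : Cmod v < 1 -> 0 < Re (1 + v).
Proof.
  intros H. rewrite re_plus. pose proof (re_le_Cmod v) as K.
  apply Rabs_le_between in K. simpl. lra.
Qed.

(** With [G] the total increment, the real function [Re (conj G * f) - |G| m] has nonpositive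
    derivative along the segment, and its increment is [|G|^2 - |G| (m 1 - m 0)]. The comparison
    function [m] lets an estimate of the derivative be integrated to a sharp bound. *)
Lemma mean_value_bound (f : C -> C) (f1 : R -> C) (m m1 : R -> R) (z e : C) :
  (forall t, 0 <= t <= 1 -> cder f (z + t * e)%C (f1 t)) ->
  (forall t, 0 <= t <= 1 -> is_derive m t (m1 t)) ->
  (forall t, 0 <= t <= 1 -> Cmod (f1 t * e) <= m1 t) ->
  Cmod (f (z + e)%C - f z) <= m 1 - m 0.
Proof.
  intros Hf Hm Hb.
  set (G := (f (z + e) - f z)%C).
  destruct (Req_dec (Cmod G) 0) as [HG|HG].
  - rewrite HG.
    destruct (MVT_cor2 m m1 0 1 Rlt_0_1) as [s [E Hs]].
    { intros t Ht. apply is_derive_Reals, Hm, Ht. }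
    specialize (Hb s ltac:(lra)). pose proof (Cmod_ge_0 (f1 s * e)). lra.
  - pose proof (Cmod_ge_0 G).
    set (g := fun t : R => Re G * Re (f (z + t * e)%C)
                     + Im G * Im (f (z + t * e)%C) - Cmod G * m t).
    set (g1 := fun t => Re G * Re (f1 t * e) + Im G * Im (f1 t * e)
                     - Cmod G * m1 t).
    destruct (MVT_cor2 g g1 0 1 Rlt_0_1) as [s [E Hs]].
    { intros t Ht. apply is_derive_Reals.
      destruct (line_derivative _ _ _ _ _ (Hf t Ht)) as [DX DY].
      specialize (Hm t Ht).
      assert (Hgen : forall (p q k : R) (X Y : R -> R), is_derive X t (Re (f1 t * e)) ->
        is_derive Y t (Im (f1 t * e)) ->
        is_derive (fun x : R => p * X x + q * Y x - k * m x) t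
          (p * Re (f1 t * e) + q * Im (f1 t * e) - k * m1 t)).
      { intros p q k X Y HX HY. auto_derive.
        - repeat split; eexists; eassumption.
        - replace (Derive (fun x : R => X x) t) with (Re (f1 t * e))
            by (symmetry; apply is_derive_unique, HX).
          replace (Derive (fun x : R => Y x) t) with (Im (f1 t * e))
            by (symmetry; apply is_derive_unique, HY).
          replace (Derive (fun x : R => m x) t) with (m1 t)
            by (symmetry; apply is_derive_unique, Hm). ring. }
      exact (Hgen (Re G) (Im G) (Cmod G) _ _ DX DY). }
    assert (Hg : g1 s <= 0).
    { unfold g1. specialize (Hb s ltac:(lra)). set (p := (f1 s * e)%C) in *.
      assert (Re G * Re p + Im G * Im p <= Cmod G * Cmod p).
      { rewrite <- (Cmod_conj G), <- Cmod_mult.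
        eapply Rle_trans; [|apply re_le_Cmod].
        eapply Rle_trans; [|apply Rle_abs].
        rewrite re_mult, re_conj, im_conj. lra. }
      assert (Cmod G * Cmod p <= Cmod G * m1 s)
        by (apply Rmult_le_compat_l; assumption).
      lra. }
    assert (E' : g 1 - g 0 = Cmod G ^ 2 - Cmod G * (m 1 - m 0)).
    { unfold g. replace (z + 1%R * e)%C with (z + e)%C by ring.
      replace (z + 0%R * e)%C with z by ring.
      rewrite Cmod2_alt. unfold G, Cminus.
      rewrite !re_plus, !im_plus, !re_opp, !im_opp. ring. }
    nra.
Qed.

(** * Subordination to a logarithm *)

Lemma twice_cexp (f : C -> C) (z : C) : twice f z -> twice (fun y => cexp (f y)) z.
Proof.
  intros (f1 & N & f2 & D). pose proof (cnear_at _ _ N) as D1. cbv beta in D1.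
  exists (fun y => cexp (f y) * f1 y)%C. split.
  - apply (cnear_imp _ _ _ (fun y H => cder_comp cexp f y _ _ (cder_cexp (f y)) H)).
    exact N.
  - eexists. apply cder_mult; [|exact D].
    exact (cder_comp cexp f z _ _ (cder_cexp (f z)) D1).
Qed.

Lemma twice_plus (f g : C -> C) (z : C) :
  twice f z -> twice g z -> twice (fun y => f y + g y)%C z.
Proof.
  intros (f1 & Nf & f2 & Df) (g1 & Ng & g2 & Dg).
  exists (fun y => f1 y + g1 y)%C. split.
  - apply (cnear_imp _ _ _ (fun y H => cder_plus f g y _ _ (proj1 H) (proj2 H))).
    apply cnear_and; assumption.
  - eexists. apply cder_plus; eassumption.
Qed.

Lemma cder_zero_const (f : C -> C) (r : R) :
  (forall z, Cmod z < r -> cder f z 0) ->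
  forall z, Cmod z < r -> f z = f 0%C.
Proof.
  intros H z Hz. apply Ceq_minus, Cmod_eq_0, Rle_antisym; [|apply Cmod_ge_0].
  assert (M : Cmod (f (0 + z)%C - f 0%C) <= (fun _ : R => 0) 1 - (fun _ : R => 0) 0).
  { apply (mean_value_bound f (fun _ => 0%C) (fun _ => 0) (fun _ => 0)).
    - intros t Ht. apply H. replace (0 + t * z)%C with (t * z)%C by ring.
      rewrite Cmod_mult, Cmod_R, Rabs_pos_eq by lra.
      pose proof (Cmod_ge_0 z). nra.
    - intros t _. apply is_derive_Reals, derivable_pt_lim_const.
    - intros t _. rewrite Cmult_0_l, Cmod_0. lra. }
  rewrite Cplus_0_l, Rminus_0_r in M. exact M.
Qed.

(** Jack's lemma is applied to [exp (F / c) - 1]. *)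
Lemma subordination_log (F F1 w : C -> C) (c B r : R) :
  c <> 0 -> 0 < Rabs B < 1 -> F 0%C = 0%C ->
  (forall z, Cmod z < r -> cder F z (F1 z)) ->
  (forall z : C, z <> 0%C -> Cmod z < r -> twice F z) ->
  (forall z, Cmod z < r -> Cmod (w z) < 1) ->
  (forall z, Cmod z < r -> z * F1 z * (1 + B * w z) = c * (B * w z))%C ->
  forall z, Cmod z < r ->
    exists v : C, Cmod v < Rabs B /\ F z = (c * Clog (1 + v))%C.
Proof.
  intros Hc HB F0 FD F2 Hw Heq z Hz.
  assert (Hc' : RtoC c <> 0%C) by (intros E; apply Hc, RtoC_inj, E).
  set (g := fun y => (/ c * F y)%C).
  set (f := fun y => (cexp (g y) + - (1))%C).
  set (g1 := fun y => (/ c * F1 y)%C).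
  assert (HD : forall y, Cmod y < r -> cder (fun y => cexp (g y)) y (cexp (g y) * g1 y)).
  { intros y Hy. apply (cder_comp cexp g); [apply cder_cexp|].
    apply cder_scal, FD, Hy. }
  assert (Hf : forall y, Cmod y < r -> Cmod (f y) < Rabs B).
  { apply (jack_subordination f (fun y => cexp (g y) * g1 y)%C w B r HB).
    - unfold f, g. rewrite F0, Cmult_0_r, cexp_0. ring.
    - intros y Hy. eapply cder_eq.
      + apply cder_plus; [apply HD, Hy|apply cder_const].
      + ring.
    - intros y Hy0 Hy. apply twice_plus; [|apply twice_const].
      apply twice_cexp, twice_mult; [apply twice_const|apply F2; assumption].
    - exact Hw.
    - intros y Hy. unfold f, g1.
      replace (y * (cexp (g y) * (/ c * F1 y)) * (1 + B * w y))%C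
        with (cexp (g y) * / c * (y * F1 y * (1 + B * w y)))%C by ring.
      rewrite Heq by exact Hy. field. exact Hc'. }
  exists (f z). split; [apply Hf, Hz|].
  assert (Hpos : forall y, Cmod y < r -> 0 < Re (cexp (g y))).
  { intros y Hy. specialize (Hf y Hy).
    replace (cexp (g y)) with (1 + f y)%C by (unfold f; ring).
    apply Re_one_plus_pos. lra. }
  (* [Clog] inverts [cexp] on this side only up to multiples of [2 pi i]; the ambiguity is excluded
     because the difference has derivative zero and vanishes at the origin. *)
  assert (E : (g z - Clog (cexp (g z)))%C = (g 0 - Clog (cexp (g 0)))%C).
  { apply (cder_zero_const (fun y => g y - Clog (cexp (g y)))%C r); [|exact Hz].
    intros y Hy. eapply cder_eq.
    - apply cder_minus; [apply cder_scal, FD, Hy|].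
      apply (cder_comp Clog (fun y => cexp (g y))).
      + apply cder_Clog, Hpos, Hy.
      + apply HD, Hy.
    - unfold g1. field. split; [exact Hc'|apply cexp_neq_0]. }
  assert (G0 : g 0%C = 0%C) by (unfold g; rewrite F0; ring).
  rewrite G0, cexp_0, Clog_1 in E.
  replace (1 + f z)%C with (cexp (g z)) by (unfold f; ring).
  replace (F z) with (c * g z)%C by (unfold g; field; exact Hc').
  f_equal. apply Ceq_minus. rewrite E. ring.
Qed.

(** * The ranges of the dominants *)

Lemma cder_Clog_one_plus (y : C) :
  Cmod y < 1 -> cder (fun x => Clog (1 + x))%C y (/ (1 + y))%C.
Proof.
  intros H. eapply cder_eq.
  - apply (cder_comp Clog (fun x => 1 + x)%C).
    + apply cder_Clog, Re_one_plus_pos, H.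
    + apply cder_plus; [apply cder_const|apply cder_id].
  - ring.
Qed.

Lemma Cmod_segment (v : C) (t : R) :
  0 <= t <= 1 -> Cmod (0 + t * v) = t * Cmod v.
Proof.
  intros H. rewrite Cplus_0_l, Cmod_mult, Cmod_R, Rabs_pos_eq; lra.
Qed.

Lemma Cmod_one_plus_lower (v : C) : 1 - Cmod v <= Cmod (1 + v).
Proof.
  pose proof (Cmod_sub_lower 1 (- v)) as H. rewrite Cmod_1, Cmod_opp in H.
  replace (1 - - v)%C with (1 + v)%C in H by ring. exact H.
Qed.

Lemma Cmod_one_plus_upper (v : C) : Cmod (1 + v) <= 1 + Cmod v.
Proof. rewrite <- Cmod_1 at 2. apply Cmod_triangle. Qed.

(** Along the segment to [v], the derivative [/ (1 + y)] is largest in modulus when [v] is negative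
    real, so the extremal value is that at [- |v|]. *)
Lemma Cmod_Clog_bound (v : C) :
  Cmod v < 1 -> Cmod (Clog (1 + v)) <= - ln (1 - Cmod v).
Proof.
  intros Hv. set (b := Cmod v) in *. assert (Hb : 0 <= b) by apply Cmod_ge_0.
  set (f := fun y => Clog (1 + y)). set (m := fun t => - ln (1 - t * b)).
  replace (Clog (1 + v))%C with (f (0 + v) - f 0)%C.
  2:{ unfold f. rewrite Cplus_0_l, Cplus_0_r, Clog_1. ring. }
  replace (- ln (1 - b)) with (m 1 - m 0).
  2:{ unfold m. rewrite Rmult_1_l, Rmult_0_l, Rminus_0_r, ln_1. ring. }
  apply (mean_value_bound _ (fun t => / (1 + (0 + t * v)))%C _
     (fun t => b / (1 - t * b))).
  - intros t Ht. apply cder_Clog_one_plus. rewrite Cmod_segment by exact Ht.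
    fold b. nra.
  - intros t Ht. unfold m. auto_derive; [nra|]. field. nra.
  - intros t Ht. pose proof (Cmod_one_plus_lower (0 + t * v)) as L.
    rewrite Cmod_segment in L by exact Ht. fold b in L.
    assert (Hp : 0 < 1 - t * b) by nra.
    rewrite Cmod_mult, Cmod_inv by (apply Cmod_gt_0; lra). fold b.
    unfold Rdiv. rewrite Rmult_comm. apply Rmult_le_compat_l; [exact Hb|].
    apply Rinv_le_contravar; lra.
Qed.

Lemma exp_monotone (x y : R) : x <= y -> exp x <= exp y.
Proof.
  intros [H| ->]; [apply Rlt_le, exp_increasing, H|apply Rle_refl].
Qed.

Lemma exp_mult_ln_div (c x : R) : 0 < x -> exp (c * ln x) / x = exp ((c - 1) * ln x).
Proof.
  intros H. replace ((c - 1) * ln x) with (c * ln x + - ln x) by ring.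
  rewrite exp_plus, exp_Ropp, exp_ln by exact H. reflexivity.
Qed.

(** [cexp (c * Clog (1 + v))] is the power [(1 + v)^c], and its derivative along the segment has
    modulus [|c| |v| |1 + t v|^(c - 1)]. The sign of [c - 1] decides which real direction is
    extremal, whence the two lemmas that follow. *)
Lemma power_path_bound (c : R) (v : C) (m m1 : R -> R) :
  Cmod v < 1 ->
  (forall t, 0 <= t <= 1 -> is_derive m t (m1 t)) ->
  (forall t, 0 <= t <= 1 ->
     Rabs c * Cmod v * exp ((c - 1) * ln (Cmod (1 + (0 + t * v)))) <= m1 t) ->
  Cmod (cexp (c * Clog (1 + v)) - 1) <= m 1 - m 0.
Proof.
  intros Hv Hm Hb.
  set (f := fun y => cexp (c * Clog (1 + y))).
  replace (cexp (c * Clog (1 + v)) - 1)%C with (f (0 + v) - f 0)%C.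
  2:{ unfold f. rewrite Cplus_0_l, Cplus_0_r, Clog_1, Cmult_0_r, cexp_0. ring. }
  assert (Hseg : forall t, 0 <= t <= 1 -> Cmod (0 + t * v) < 1).
  { intros t Ht. rewrite Cmod_segment by exact Ht.
    pose proof (Cmod_ge_0 v). nra. }
  apply (mean_value_bound _ (fun t => cexp (c * Clog (1 + (0 + t * v)))
      * (c * / (1 + (0 + t * v))))%C m m1); [|exact Hm|].
  - intros t Ht. apply (cder_comp cexp (fun y => c * Clog (1 + y))%C).
    + apply cder_cexp.
    + apply cder_scal, cder_Clog_one_plus, Hseg, Ht.
  - intros t Ht. eapply Rle_trans; [|apply Hb, Ht].
    set (u := (1 + (0 + t * v))%C).
    assert (Hu : 0 < Cmod u).
    { apply Cmod_gt_0, Re_pos_neq_0, Re_one_plus_pos, Hseg, Ht. }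
    rewrite !Cmod_mult, Cmod_cexp, Cmod_R, Cmod_inv by (apply Cmod_gt_0, Hu).
    rewrite re_scal_l. change (Re (Clog u)) with (ln (Cmod u)).
    rewrite <- exp_mult_ln_div by exact Hu. apply Req_le. unfold Rdiv. ring.
Qed.

Lemma power_bound_ge_1 (c : R) (v : C) :
  1 <= c -> Cmod v < 1 ->
  Cmod (cexp (c * Clog (1 + v)) - 1) <= exp (c * ln (1 + Cmod v)) - 1.
Proof.
  intros Hc Hv. set (b := Cmod v) in *. assert (Hb : 0 <= b) by apply Cmod_ge_0.
  set (m := fun t => exp (c * ln (1 + t * b))).
  replace (exp (c * ln (1 + b)) - 1) with (m 1 - m 0).
  2:{ unfold m. rewrite Rmult_1_l, Rmult_0_l, Rplus_0_r, ln_1, Rmult_0_r, exp_0.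
      ring. }
  apply (power_path_bound _ _ _
    (fun t => Rabs c * b * exp ((c - 1) * ln (1 + t * b))) Hv).
  - intros t Ht. assert (Hp : 0 < 1 + t * b) by nra.
    rewrite <- exp_mult_ln_div, Rabs_pos_eq by lra.
    unfold m. auto_derive; [exact Hp|]. field. lra.
  - intros t Ht. fold b. apply Rmult_le_compat_l.
    { apply Rmult_le_pos; [apply Rabs_pos|exact Hb]. }
    assert (Hseg : Cmod (0 + t * v) = t * b) by (apply Cmod_segment, Ht).
    apply exp_monotone, Rmult_le_compat_l; [lra|].
    apply ln_le.
    + apply Cmod_gt_0, Re_pos_neq_0, Re_one_plus_pos. rewrite Hseg. nra.
    + rewrite <- Hseg. apply Cmod_one_plus_upper.
Qed.

(** The exponent [c - 1] is nonpositive, so the extremal direction is the one in which [1 + t v]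
    comes closest to [0]. The quotient [Rabs c / c] is the sign of [c]. *)
Lemma power_bound_lt_1 (c : R) (v : C) :
  c <= 1 -> c <> 0 -> Cmod v < 1 ->
  Cmod (cexp (c * Clog (1 + v)) - 1)
    <= Rabs c / c * (1 - exp (c * ln (1 - Cmod v))).
Proof.
  intros Hc Hc0 Hv. set (b := Cmod v) in *. assert (Hb : 0 <= b) by apply Cmod_ge_0.
  set (s := Rabs c / c).
  set (m := fun t => - s * exp (c * ln (1 - t * b))).
  replace (s * (1 - exp (c * ln (1 - b)))) with (m 1 - m 0).
  2:{ unfold m. rewrite Rmult_1_l, Rmult_0_l, Rminus_0_r, ln_1, Rmult_0_r, exp_0.
      ring. }
  apply (power_path_bound _ _ _
    (fun t => Rabs c * b * exp ((c - 1) * ln (1 - t * b))) Hv).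
  - intros t Ht. assert (Hp : 0 < 1 - t * b) by nra.
    rewrite <- exp_mult_ln_div by lra.
    replace (Rabs c) with (s * c) by (unfold s; field; exact Hc0).
    unfold m. generalize s. intros s'.
    auto_derive; [lra|]. unfold Rminus. field. lra.
  - intros t Ht. fold b. apply Rmult_le_compat_l.
    { apply Rmult_le_pos; [apply Rabs_pos|exact Hb]. }
    assert (Hseg : Cmod (0 + t * v) = t * b) by (apply Cmod_segment, Ht).
    assert (Hln : ln (1 - t * b) <= ln (Cmod (1 + (0 + t * v)))).
    { apply ln_le; [nra|]. rewrite <- Hseg. apply Cmod_one_plus_lower. }
    apply exp_monotone. nra.
Qed.

Lemma Clog_scal (a : R) (z : C) :
  0 < a -> 0 < Re z -> Clog (a * z) = (ln a + Clog z)%C.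
Proof.
  intros Ha Hz. unfold Clog.
  rewrite Cmod_mult, Cmod_R, Rabs_pos_eq, re_scal_l, im_scal_l by lra.
  rewrite ln_mult; [|exact Ha|apply Cmod_gt_0, Re_pos_neq_0, Hz].
  apply injective_projections; simpl; [reflexivity|].
  rewrite Rplus_0_l. f_equal. field. lra.
Qed.

Lemma Re_cayley_pos (y : C) : Cmod y < 1 -> 0 < Re ((1 + y) / (1 - y)).
Proof.
  intros Hy. assert (Hp : 0 < Cmod (1 - y)).
  { pose proof (Cmod_one_plus_lower (- y)) as H. rewrite Cmod_opp in H.
    unfold Cminus. lra. }
  assert (Hy2 : Re y ^ 2 + Im y ^ 2 < 1).
  { rewrite <- Cmod2_alt. pose proof (Cmod_ge_0 y). nra. }
  assert (Hd : 0 < (1 - Re y) ^ 2 + Im y ^ 2).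
  { pose proof (Cmod2_alt (1 - y)) as E. unfold Cminus in E.
    rewrite re_plus, im_plus, re_opp, im_opp in E. simpl (Re 1) in E.
    simpl (Im 1) in E. unfold Cminus in Hp.
    replace (0 + - Im y) with (- Im y) in E by ring. nra. }
  replace (Re ((1 + y) / (1 - y)))
    with ((1 - (Re y ^ 2 + Im y ^ 2)) / ((1 - Re y) ^ 2 + Im y ^ 2)).
  - apply Rdiv_lt_0_compat; lra.
  - destruct y as [p q]. simpl Re in *. simpl Im in *. simpl. field. nra.
Qed.

(** The derivative [2 / (1 - x^2)] is largest in modulus at real [x] among points of given modulus,
    so the bound is the value at [|y|]. *)
Lemma Cmod_Clog_cayley (y : C) :
  Cmod y < 1 ->
  Cmod (Clog ((1 + y) / (1 - y))) <= ln (1 + Cmod y) - ln (1 - Cmod y).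
Proof.
  intros Hy. set (b := Cmod y) in *. assert (Hb : 0 <= b) by apply Cmod_ge_0.
  set (f := fun x => Clog ((1 + x) / (1 - x))%C).
  replace (Clog ((1 + y) / (1 - y)))%C with (f (0 + y) - f 0)%C.
  2:{ unfold f. replace ((1 + 0) / (1 - 0))%C with (RtoC 1) by (field; apply C1_nz).
      rewrite Cplus_0_l, Clog_1. ring. }
  set (m := fun t => ln (1 + t * b) - ln (1 - t * b)).
  replace (ln (1 + b) - ln (1 - b)) with (m 1 - m 0).
  2:{ unfold m. rewrite Rmult_1_l, Rmult_0_l, Rminus_0_r, Rplus_0_r, ln_1. ring. }
  assert (Hseg : forall t, 0 <= t <= 1 -> Cmod (0 + t * y) = t * b)
    by (intros; apply Cmod_segment; assumption).
  assert (Hlt : forall t, 0 <= t <= 1 -> Cmod (0 + t * y) < 1)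
    by (intros t Ht; rewrite Hseg by exact Ht; nra).
  assert (Hp : forall x, Cmod x < 1 -> (1 + x)%C <> 0%C /\ (1 - x)%C <> 0%C).
  { intros x Hx. split; apply Cmod_gt_0.
    - pose proof (Cmod_one_plus_lower x). lra.
    - pose proof (Cmod_one_plus_lower (- x)) as H. rewrite Cmod_opp in H.
      unfold Cminus. lra. }
  apply (mean_value_bound f (fun t => 2 / (1 - (0 + t * y) * (0 + t * y)))%C _
    (fun t => 2 * b / (1 - t * b * (t * b)))).
  - intros t Ht. specialize (Hlt t Ht). set (x := (0 + t * y)%C) in *.
    destruct (Hp x Hlt) as [H1 H2]. eapply cder_eq.
    + apply (cder_comp Clog (fun x => (1 + x) / (1 - x))%C).
      * apply cder_Clog, Re_cayley_pos, Hlt.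
      * apply cder_div; [exact H2| |].
        -- apply cder_plus; [apply cder_const|apply cder_id].
        -- apply cder_minus; [apply cder_const|apply cder_id].
    + replace (1 - x * x)%C with ((1 + x) * (1 - x))%C by ring.
      field. auto.
  - intros t Ht. assert (0 <= t * b < 1) by nra.
    unfold m. auto_derive; [lra|]. field. split; nra.
  - intros t Ht. specialize (Hseg t Ht). specialize (Hlt t Ht).
    set (x := (0 + t * y)%C) in *. destruct (Hp x Hlt) as [H1 H2].
    assert (Hx : 0 <= t * b < 1) by (rewrite <- Hseg; split; [apply Cmod_ge_0|lra]).
    pose proof (Cmod_one_plus_lower (- (x * x))) as L.
    rewrite Cmod_opp, Cmod_mult, Hseg in L.
    change (1 + - (x * x))%C with (1 - x * x)%C in L.
    assert (Hq : 0 < 1 - t * b * (t * b)) by nra.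
    unfold Cdiv. rewrite !Cmod_mult, Cmod_inv by (apply Cmod_gt_0; lra).
    rewrite Cmod_R, Rabs_pos_eq by lra. fold b.
    replace (2 * / Cmod (1 - x * x) * b) with (2 * b * / Cmod (1 - x * x)) by ring.
    unfold Rdiv. apply Rmult_le_compat_l; [lra|].
    apply Rinv_le_contravar; lra.
Qed.

(** [1 + v] lies in the disc with real diameter [1 - b, 1 + b]; dividing by
    [sqrt (1 - b^2)] centres it hyperbolically at [1], and the Cayley transform
    turns it into [|k| <= tanh (a / 2)], [a = ln ((1 + b) / (1 - b)) / 2]. *)
Lemma Clog_in_disc (v : C) (b : R) :
  Cmod v <= b -> b < 1 ->
  (Re (Clog (1 + v)) - ln (1 - b)) * (Re (Clog (1 + v)) - ln (1 + b))
    + Im (Clog (1 + v)) ^ 2 <= 0.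
Proof.
  intros Hv Hb. assert (Hb0 : 0 <= b) by (pose proof (Cmod_ge_0 v); lra).
  set (g := sqrt ((1 + b) / (1 - b))).
  assert (Hg2 : g * g = (1 + b) / (1 - b)).
  { apply sqrt_sqrt, Rlt_le, Rdiv_lt_0_compat; lra. }
  assert (Hg : 1 <= g).
  { unfold g. rewrite <- sqrt_1 at 1. apply sqrt_le_1_alt.
    apply (Rmult_le_reg_r (1 - b)); [lra|]. unfold Rdiv.
    rewrite Rmult_assoc, Rinv_l; lra. }
  (* [e] is [sqrt (1 - b^2)], and [ln (1 + b)], [ln (1 - b)] are [ln e + ln g], [ln e - ln g]: the
     disc of the conclusion has centre [ln e] and radius [ln g]. *)
  set (e := (1 - b) * g).
  assert (He : 0 < e) by (unfold e; nra).
  assert (Heg : e * g = 1 + b).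
  { unfold e. rewrite Rmult_assoc, Hg2. field. lra. }
  assert (Hlg : 2 * ln g = ln (1 + b) - ln (1 - b)).
  { replace (2 * ln g) with (ln (g * g)) by (rewrite ln_mult; lra).
    rewrite Hg2, ln_div; lra. }
  assert (Hle : 2 * ln e = ln (1 + b) + ln (1 - b)).
  { unfold e. rewrite ln_mult by lra. lra. }
  assert (Hre : 0 < Re (1 + v)) by (apply Re_one_plus_pos; lra).
  set (s := (1 + v)%C) in *.
  assert (Hse : (s + e)%C <> 0%C).
  { apply Re_pos_neq_0. rewrite re_plus. simpl (Re e). lra. }
  set (k := ((s - e) / (s + e))%C).
  assert (Hk : Cmod k <= (g - 1) / (g + 1)).
  { unfold k. rewrite Cmod_div by exact Hse.
    assert (Hsep : 0 < Cmod (s + e)) by (apply Cmod_gt_0, Hse).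
    apply (Rmult_le_reg_r (Cmod (s + e))); [exact Hsep|].
    unfold Rdiv at 1. rewrite Rmult_assoc, Rinv_l, Rmult_1_r by lra.
    apply (Rmult_le_reg_l (g + 1)); [lra|].
    replace ((g + 1) * ((g - 1) / (g + 1) * Cmod (s + e)))
      with ((g - 1) * Cmod (s + e)) by (field; lra).
    assert (N1 := Cmod2_alt (s - e)). assert (N2 := Cmod2_alt (s + e)).
    unfold Cminus in N1.
    rewrite re_plus, im_plus, re_opp, im_opp in N1.
    rewrite re_plus, im_plus in N2. fold (Cminus s e) in N1.
    assert (Nv : (Re s - 1) ^ 2 + Im s ^ 2 <= b ^ 2).
    { replace ((Re s - 1) ^ 2 + Im s ^ 2) with (Cmod v ^ 2).
      - apply pow_incr. split; [apply Cmod_ge_0|exact Hv].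
      - rewrite Cmod2_alt. unfold s. rewrite re_plus, im_plus.
        simpl (Re 1). simpl (Im 1). ring. }
    simpl (Re e) in *. simpl (Im e) in *.
    (* The difference of the two sides simplifies to [4 g (|s - 1|^2 - b^2)]. *)
    assert (Hsq : ((g + 1) * Cmod (s - e)) ^ 2 <= ((g - 1) * Cmod (s + e)) ^ 2).
    { rewrite !Rpow_mult_distr, N1, N2.
      apply Rminus_le.
      replace ((g + 1) ^ 2 * ((Re s + - e) ^ 2 + (Im s + - 0) ^ 2)
        - (g - 1) ^ 2 * ((Re s + e) ^ 2 + (Im s + 0) ^ 2))
        with (4 * g * (Re s ^ 2 + Im s ^ 2 + e * e)
              - 4 * Re s * (g * (e * g) + e)) by ring.
      assert (Hee : e * e = 1 - b ^ 2).
      { replace (e * e) with ((1 - b) * (e * g)) by (unfold e; ring).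
        rewrite Heg. ring. }
      rewrite Hee, Heg. unfold e.
      replace (4 * g * (Re s ^ 2 + Im s ^ 2 + (1 - b ^ 2))
         - 4 * Re s * (g * (1 + b) + (1 - b) * g))
        with (4 * g * ((Re s - 1) ^ 2 + Im s ^ 2 - b ^ 2)) by ring.
      nra. }
    apply Rsqr_incr_0_var.
    - unfold Rsqr. simpl in Hsq. rewrite !Rmult_1_r in Hsq. exact Hsq.
    - apply Rmult_le_pos; [lra|apply Cmod_ge_0]. }
  assert (Hk1 : Cmod k < 1).
  { eapply Rle_lt_trans; [exact Hk|]. apply (Rmult_lt_reg_r (g + 1)); [lra|].
    unfold Rdiv. rewrite Rmult_assoc, Rinv_l; lra. }
  pose proof (Cmod_Clog_cayley k Hk1) as HC.
  assert (Ek : ((1 + k) / (1 - k))%C = (RtoC (/ e) * s)%C).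
  { assert (He0 : RtoC e <> 0%C) by (intros E; apply RtoC_inj in E; lra).
    rewrite RtoC_inv by lra. unfold k. field.
    split; [exact He0|]. split; [exact Hse|].
    replace (s + e - (s - e))%C with (2 * e)%C by ring.
    apply Cmult_neq_0; [|exact He0]. intros E. apply RtoC_inj in E. lra. }
  rewrite Ek, Clog_scal, ln_Rinv in HC
    by (try exact Hre; try exact He; apply Rinv_0_lt_compat, He).
  assert (HD : ln (1 + Cmod k) - ln (1 - Cmod k) <= ln g).
  { rewrite <- ln_div by (pose proof (Cmod_ge_0 k); lra).
    apply ln_le; [apply Rdiv_lt_0_compat; pose proof (Cmod_ge_0 k); lra|].
    apply (Rmult_le_reg_r (1 - Cmod k)); [lra|]. unfold Rdiv.
    rewrite Rmult_assoc, Rinv_l, Rmult_1_r by lra.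
    apply (Rmult_le_compat_r (g + 1)) in Hk; [|lra].
    replace ((g - 1) / (g + 1) * (g + 1)) with (g - 1) in Hk by (field; lra).
    lra. }
  assert (HF : Cmod (RtoC (- ln e) + Clog s) ^ 2 <= ln g ^ 2).
  { apply pow_incr. split; [apply Cmod_ge_0|lra]. }
  rewrite Cmod2_alt, re_plus, im_plus in HF. simpl (Re (RtoC _)) in HF.
  simpl (Im (RtoC _)) in HF. rewrite Rplus_0_l in HF.
  replace (ln (1 + b)) with (ln e + ln g) by lra.
  replace (ln (1 - b)) with (ln e - ln g) by lra.
  nra.
Qed.

Lemma ln_one_minus_lt (a b : R) : a < b -> b < 1 -> - ln (1 - a) < - ln (1 - b).
Proof.
  intros Hab Hb. apply Ropp_lt_contravar, ln_increasing; lra.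
Qed.

(** The extremal point of [|v| = |B|] is [- |B|], that is, [1 - B] or [1 + B] in the logarithm
    according to the sign of [B]; [c] has the same sign as [B]. *)
Lemma scaled_Clog_bound (B c : R) (v : C) :
  0 < c * B -> Rabs B < 1 -> Cmod v < Rabs B ->
  Cmod (c * Clog (1 + v)) < Rmax (- (c * ln (1 - B))) (c * ln (1 + B)).
Proof.
  intros HcB HB Hv. rewrite Cmod_mult, Cmod_R.
  pose proof (Cmod_Clog_bound v ltac:(lra)) as H.
  pose proof (ln_one_minus_lt _ _ Hv HB) as Hl.
  destruct (Rlt_or_le 0 B) as [HB0|HB0].
  - assert (Hc : 0 < c) by nra.
    rewrite Rabs_pos_eq in Hl |- * by lra. rewrite (Rabs_pos_eq B) in * by lra.
    eapply Rlt_le_trans; [|apply Rmax_l]. nra.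
  - assert (Hc : c < 0) by nra.
    rewrite (Rabs_left c) by lra. rewrite (Rabs_left1 B) in * by lra.
    replace (1 - - B) with (1 + B) in Hl by ring.
    eapply Rlt_le_trans; [|apply Rmax_r]. nra.
Qed.

(** For [B > 0] the far end [1 + B] is extremal if [c >= 1] and the near end [1 - B] if [c < 1]; for
    [B < 0] the exponent is negative and the end [1 + B], nearest to the origin, is extremal. *)
Lemma scaled_power_bound (B c : R) (v : C) :
  0 < c * B -> Rabs B < 1 -> Cmod v < Rabs B ->
  Cmod (cexp (c * Clog (1 + v)) - 1)
    < Rmax (1 - exp (c * ln (1 - B))) (exp (c * ln (1 + B)) - 1).
Proof.
  intros HcB HB Hv. pose proof (ln_one_minus_lt _ _ Hv HB) as Hl.
  pose proof (Cmod_ge_0 v) as Hv0.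
  destruct (Rlt_or_le 0 B) as [HB0|HB0].
  - assert (Hc : 0 < c) by nra. rewrite (Rabs_pos_eq B) in * by lra.
    destruct (Rle_or_lt 1 c) as [Hc1|Hc1].
    + eapply Rlt_le_trans; [|apply Rmax_r].
      eapply Rle_lt_trans; [apply power_bound_ge_1; lra|].
      apply Rplus_lt_compat_r, exp_increasing, Rmult_lt_compat_l; [lra|].
      apply ln_increasing; lra.
    + eapply Rlt_le_trans; [|apply Rmax_l].
      eapply Rle_lt_trans; [apply power_bound_lt_1; lra|].
      rewrite Rabs_pos_eq by lra. unfold Rdiv. rewrite Rinv_r, Rmult_1_l by lra.
      apply Rplus_lt_compat_l, Ropp_lt_contravar, exp_increasing. nra.
  - assert (Hc : c < 0) by nra. rewrite (Rabs_left1 B) in * by lra.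
    replace (1 - - B) with (1 + B) in Hl by ring.
    eapply Rlt_le_trans; [|apply Rmax_r].
    eapply Rle_lt_trans; [apply power_bound_lt_1; lra|].
    rewrite Rabs_left by lra.
    replace (- c / c) with (-1) by (field; lra).
    assert (exp (c * ln (1 - Cmod v)) < exp (c * ln (1 + B)))
      by (apply exp_increasing; nra).
    lra.
Qed.

(** For [p = 1 / (1 - F)] the claim is [|p - 1| < 2/3], and it places [F] in the disc of real
    diameter from [-2] to [2/5]. If [B < 0], then [|F| < 2/5] is available and suffices. If [B > 0],
    the modulus is bounded only by [2], so the finer [Clog_in_disc] is needed: it puts [F] in a disc
    whose real diameter lies in that interval. *)
Lemma inversion_bound (B c : R) (v : C) :
  0 < c * B -> Rabs B < 1 -> Cmod v < Rabs B ->
  -2 <= c * ln (1 - B) -> c * ln (1 + B) <= 2 / 5 ->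
  3 * Cmod (c * Clog (1 + v)) < 2 * Cmod (1 - c * Clog (1 + v)).
Proof.
  intros HcB HB Hv H1 H2. set (F := (c * Clog (1 + v))%C).
  destruct (Rlt_or_le 0 B) as [HB0|HB0].
  - assert (Hc : 0 < c) by nra. rewrite (Rabs_pos_eq B) in * by lra.
    set (b := Cmod v) in *. assert (Hb : 0 <= b) by apply Cmod_ge_0.
    pose proof (Clog_in_disc v b (Rle_refl _) ltac:(lra)) as HD.
    assert (E1 : Re F = c * Re (Clog (1 + v))) by apply re_scal_l.
    assert (E2 : Im F = c * Im (Clog (1 + v))) by apply im_scal_l.
    set (X := Re F) in *. set (Y := Im F) in *.
    set (al := c * ln (1 + b)). set (ga := - (c * ln (1 - b))).
    assert (Hal : 0 <= al < 2 / 5).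
    { split.
      - apply Rmult_le_pos; [lra|]. rewrite <- ln_1. apply ln_le; lra.
      - eapply Rlt_le_trans; [|exact H2]. apply Rmult_lt_compat_l; [exact Hc|].
        apply ln_increasing; lra. }
    assert (Hga : 0 <= ga < 2).
    { pose proof (ln_one_minus_lt _ _ Hv HB) as Hl. split.
      - assert (ln (1 - b) <= ln 1) by (apply ln_le; lra).
        rewrite ln_1 in H. unfold ga. nra.
      - unfold ga. nra. }
    assert (HD' : (X + ga) * (X - al) + Y ^ 2 <= 0).
    { replace ((X + ga) * (X - al) + Y ^ 2) with
        (c ^ 2 * ((Re (Clog (1 + v)) - ln (1 - b)) *
         (Re (Clog (1 + v)) - ln (1 + b)) + Im (Clog (1 + v)) ^ 2))
        by (rewrite E1, E2; unfold al, ga; ring).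
      pose proof (pow2_ge_0 c). nra. }
    assert (HX : - ga <= X <= al) by (pose proof (pow2_ge_0 Y); nra).
    (* affine in [X] once [X^2 + Y^2] is bounded, hence checked at the ends *)
    assert (HN : 5 * (X ^ 2 + Y ^ 2) + 8 * X - 4 < 0).
    { assert (T : 5 * al * ga - 5 * (ga - al) * X + 8 * X - 4 < 0).
      { assert (A1 : (5 * al - 2) * (al + 2) < 0) by nra.
        assert (A2 : (5 * ga + 2) * (ga - 2) < 0) by nra.
        destruct (Req_dec (al + ga) 0) as [H0|H0]; [nra|].
        assert (A3 : (X + ga) * ((5 * al - 2) * (al + 2))
           + (al - X) * ((5 * ga + 2) * (ga - 2)) < 0).
        { assert (0 < X + ga \/ 0 < al - X) as [|] by lra; nra. }
        apply (Rmult_lt_reg_l (al + ga)); [lra|]. nra. }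
      nra. }
    apply Rsqr_incrst_0; try (apply Rmult_le_pos; [lra|apply Cmod_ge_0]).
    replace (Rsqr (3 * Cmod F)) with (9 * Cmod F ^ 2) by (unfold Rsqr; ring).
    replace (Rsqr (2 * Cmod (1 - F))) with (4 * Cmod (1 - F) ^ 2)
      by (unfold Rsqr; ring).
    rewrite !Cmod2_alt. unfold Cminus.
    rewrite re_plus, im_plus, re_opp, im_opp. fold X Y.
    simpl (Re 1). simpl (Im 1). nra.
  - assert (Hc : c < 0) by nra.
    pose proof (Cmod_Clog_bound v ltac:(lra)) as H.
    pose proof (ln_one_minus_lt _ _ Hv HB) as Hl.
    rewrite (Rabs_left1 B) in * by lra.
    replace (1 - - B) with (1 + B) in Hl by ring.
    assert (HF : Cmod F < 2 / 5).
    { unfold F. rewrite Cmod_mult, Cmod_R, Rabs_left by lra. nra. }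
    pose proof (Cmod_one_plus_lower (- F)) as L. rewrite Cmod_opp in L.
    fold (Cminus 1 F) in L. lra.
Qed.

Lemma Cmod_RtoC_mult (t : R) (z : C) : 0 <= t -> Cmod (t * z) = t * Cmod z.
Proof. intros H. rewrite Cmod_mult, Cmod_R, Rabs_pos_eq; auto. Qed.

(** Looking at a point of least modulus where [|p - 1| >= 1], one may assume
    that [|p - 1| < 1]; in particular [p] has no zeros. *)
Lemma bootstrap (p : C -> C) :
  (forall z, Cmod z < 1 -> ccont p z) -> p 0%C = 1%C ->
  (forall r, r <= 1 -> (forall z, Cmod z < r -> Cmod (p z - 1) < 1) ->
     forall z, Cmod z < r -> Cmod (p z - 1) < 2 / 3) ->
  forall z, Cmod z < 1 -> Cmod (p z - 1) < 2 / 3.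
Proof.
  intros Hc P0 H. apply H; [lra|]. intros a Ha. apply Rnot_le_lt. intros Hpa.
  destruct (compact_max (fun z => Cmod z <= Cmod a /\ 1 <= Cmod (p z - 1))
    (Cmod a) (fun z => - Cmod z) a) as [z0 [[K1 K2] Hmin]].
  - tauto.
  - intros z Hz. destruct (Rle_or_lt (Cmod z) (Cmod a)) as [Hza|Hza].
    + assert (Hlt : Cmod (p z - 1) < 1) by (apply Rnot_le_lt; tauto).
      apply (cnear_imp _ (fun y => Cmod (p y - p z) < 1 - Cmod (p z - 1))).
      * intros y Hy [_ Hy2].
        replace (p y - 1)%C with ((p y - p z) + (p z - 1))%C in Hy2 by ring.
        pose proof (Cmod_triangle (p y - p z) (p z - 1)). lra.
      * apply Hc; lra.
    + apply (cnear_imp _ (fun y => ~ Cmod y <= Cmod a)); [tauto|].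
      apply closed_disc_complement. lra.
  - intros z _. apply (rcont_comp Cmod Ropp).
    + apply derivable_continuous_pt. exists (-1).
      apply is_derive_Reals. auto_derive; [exact I|ring].
    + apply (Cmod_rcont (fun y => y)), ccont_id.
  - split; [lra|exact Hpa].
  - assert (Hin : forall z, Cmod z < Cmod z0 -> Cmod (p z - 1) < 1).
    { intros z Hz. apply Rnot_le_lt. intros Hz1.
      assert (Hza : Cmod z <= Cmod a) by lra.
      specialize (Hmin z (conj Hza Hz1)). cbv beta in Hmin. lra. }
    specialize (H (Cmod z0) ltac:(lra) Hin).
    assert (Hz0 : 0 < Cmod z0).
    { apply Cmod_gt_0. intros E. rewrite E, P0, Cmod_sub_self in K2. lra. }
    (* Just inside [z0] the bound is [2/3], and [1/3] is the gap up to the value at least [1] at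
       [z0]. *)
    destruct (Hc z0 ltac:(lra) (1 / 3) ltac:(lra)) as [d [Hd HK]].
    set (t := Rmin (1 / 2) (d / 2)).
    assert (Ht : 0 < t) by (apply Rmin_pos; lra).
    assert (Ht2 : t <= 1 / 2) by apply Rmin_l.
    assert (Ht3 : t <= d / 2) by apply Rmin_r.
    set (y := (RtoC (1 - t) * z0)%C).
    assert (Hy1 : Cmod y < Cmod z0).
    { unfold y. rewrite Cmod_RtoC_mult by lra. nra. }
    assert (Hy2 : Cmod (y - z0) < d).
    { replace (y - z0)%C with (- (t * z0))%C
        by (unfold y; rewrite RtoC_minus; ring).
      rewrite Cmod_opp, Cmod_RtoC_mult by lra. nra. }
    specialize (H y Hy1). specialize (HK y Hy2). rewrite Cmod_sub_sym in HK.
    replace (p z0 - 1)%C with ((p z0 - p y) + (p y - 1))%C in K2 by ring.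
    pose proof (Cmod_triangle (p z0 - p y) (p y - 1)). lra.
Qed.

(** * The nephroid domain *)

Lemma cube_difference (x y : C) :
  ((x - x ^ 3 / 3) - (y - y ^ 3 / 3))%C
  = ((x - y) * (1 - (x * x + x * y + y * y) / 3))%C.
Proof. simpl. field. Qed.

Lemma Cmod_div_3 (z : C) : Cmod (z / 3) = Cmod z / 3.
Proof.
  rewrite Cmod_div by (intros E; apply RtoC_inj in E; lra).
  rewrite Cmod_R, Rabs_pos_eq by lra. reflexivity.
Qed.

(** [x |-> u + x^3/3] contracts the disc of radius [r], where
    [r - r^3/3 >= |u|]; a minimiser of [|u + x^3/3 - x|] is then a fixed point. *)
Lemma nephroid_preimage (u : C) :
  Cmod u < 2 / 3 -> exists x : C, Cmod x < 1 /\ (x - x ^ 3 / 3)%C = u.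
Proof.
  intros Hu.
  (* For [r = 1 - h] one has [r - r^3/3 = 2/3 - h^2 + h^3/3], which is at least [|u|] when
     [h^2 = 2/3 - |u|]. *)
  set (h := sqrt (2 / 3 - Cmod u)).
  assert (Hh2 : h * h = 2 / 3 - Cmod u) by (apply sqrt_sqrt; lra).
  assert (Hh : 0 < h) by (apply sqrt_lt_R0; lra).
  pose proof (Cmod_ge_0 u) as Hu0.
  set (r := 1 - h).
  assert (Hh1 : h < 1) by nra.
  assert (Hr : 0 < r < 1) by (unfold r; lra).
  assert (Hur : Cmod u + r ^ 3 / 3 <= r).
  { assert (0 <= h ^ 3) by (apply pow_le; lra). unfold r. nra. }
  set (T := fun x => (u + x ^ 3 / 3)%C).
  assert (T1 : forall x, Cmod x <= r -> Cmod (T x) <= r).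
  { intros x Hx. unfold T. eapply Rle_trans; [apply Cmod_triangle|].
    rewrite Cmod_div_3, Cmod_pow.
    assert (Cmod x ^ 3 <= r ^ 3) by (apply pow_incr; split; [apply Cmod_ge_0|exact Hx]).
    lra. }
  assert (T2 : forall x y, Cmod x <= r -> Cmod y <= r ->
     Cmod (T x - T y) <= r * r * Cmod (x - y)).
  { intros x y Hx Hy.
    replace (T x - T y)%C with ((x - y) * ((x * x + x * y + y * y) / 3))%C
      by (unfold T; simpl; field).
    rewrite Cmod_mult, Cmod_div_3, Rmult_comm.
    apply Rmult_le_compat_r; [apply Cmod_ge_0|].
    pose proof (Cmod_triangle (x * x + x * y) (y * y)) as A1.
    pose proof (Cmod_triangle (x * x) (x * y)) as A2.
    rewrite !Cmod_mult in *. pose proof (Cmod_ge_0 x). pose proof (Cmod_ge_0 y).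
    assert (Cmod x * Cmod x <= r * r) by nra.
    assert (Cmod x * Cmod y <= r * r) by nra.
    assert (Cmod y * Cmod y <= r * r) by nra.
    lra. }
  assert (DT : forall x, exists d, cder (fun y => T y + - y)%C x d).
  { intros x. eexists. apply cder_plus; [|apply cder_opp, cder_id].
    apply cder_plus; [apply cder_const|].
    apply cder_ext with (fun y => / 3 * (y * (y * y)))%C.
    - intros y. simpl. field.
    - apply cder_scal, cder_mult; [apply cder_id|].
      apply cder_mult; apply cder_id. }
  destruct (compact_max (fun x => Cmod x <= r) r
     (fun x => - Cmod (T x + - x)) 0%C) as [x [Kx Hmin]].
  - auto.
  - apply closed_disc_complement.
  - intros x _. apply (rcont_comp (fun y => Cmod (T y + - y)) Ropp).
    + apply derivable_continuous_pt. exists (-1).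
      apply is_derive_Reals. auto_derive; [exact I|ring].
    + destruct (DT x) as [d D]. exact (Cmod_rcont _ _ (cder_ccont _ _ _ D)).
  - rewrite Cmod_0. lra.
  - exists x. split; [lra|].
    (* Comparing the minimiser [x] with [T x], whose defect is at most [r^2] times that of [x],
       leaves only defect zero. *)
    specialize (Hmin (T x) (T1 x Kx)). cbv beta in Hmin.
    specialize (T2 (T x) x (T1 x Kx) Kx). unfold Cminus in T2.
    pose proof (Cmod_ge_0 (T x + - x)).
    assert (Hrr : 0 < 1 - r * r) by (clear - Hr; nra).
    assert (E : (T x + - x)%C = 0%C).
    { apply Cmod_eq_0, Rle_antisym; [|exact H].
      apply (Rmult_le_reg_l (1 - r * r)); [exact Hrr|]. lra. }
    replace u with (T x - x ^ 3 / 3)%C by (unfold T; ring).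
    replace (T x) with (T x + - x + x)%C by ring. rewrite E. ring.
Qed.

(** By [cube_difference] this bounds the difference quotient of [x - x^3/3] from below. The bound
    does not depend on [x], so it yields both injectivity and the continuity of the inverse at
    [y]. *)
Lemma quadratic_form_bound (x y : C) :
  Cmod x < 1 -> Cmod y < 1 ->
  (1 - Cmod y) / 3 <= Cmod (1 - (x * x + x * y + y * y) / 3).
Proof.
  intros Hx Hy. pose proof (Cmod_one_plus_lower (- ((x * x + x * y + y * y) / 3))) as L.
  fold (Cminus 1 ((x * x + x * y + y * y) / 3)) in L.
  rewrite Cmod_opp, Cmod_div_3 in L.
  pose proof (Cmod_triangle (x * x + x * y) (y * y)) as A1.
  pose proof (Cmod_triangle (x * x) (x * y)) as A2.
  rewrite !Cmod_mult in *. pose proof (Cmod_ge_0 x). pose proof (Cmod_ge_0 y).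
  nra.
Qed.

Lemma nephroid_injective (x y : C) :
  Cmod x < 1 -> Cmod y < 1 -> (x - x ^ 3 / 3)%C = (y - y ^ 3 / 3)%C -> x = y.
Proof.
  intros Hx Hy E. apply Ceq_minus, Cmod_eq_0.
  pose proof (quadratic_form_bound x y Hx Hy) as Q.
  pose proof (cube_difference x y) as D. rewrite E in D.
  replace (y - y ^ 3 / 3 - (y - y ^ 3 / 3))%C with (RtoC 0) in D by ring.
  apply (f_equal Cmod) in D. rewrite Cmod_0, Cmod_mult in D.
  pose proof (Cmod_ge_0 (x - y)). apply Rle_antisym; nra.
Qed.

Lemma analytic_on_disc_cder (f : C -> C) :
  analytic_on_disc f <-> (forall z, Cmod z < 1 -> exists d, cder f z d).
Proof.
  split; intros H z Hz; destruct (H z Hz) as [d D]; exists d;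
    apply cder_is_derive; exact D.
Qed.

Lemma cder_nephroid (z : C) : cder (fun y => y - y ^ 3 / 3)%C z (1 - z * z)%C.
Proof.
  eapply cder_eq.
  - apply cder_minus; [apply cder_id|].
    apply cder_ext with (fun y => / 3 * (y * (y * y)))%C.
    + intros y. simpl. field.
    + apply cder_scal, cder_mult; [apply cder_id|].
      apply cder_mult; apply cder_id.
  - cbv beta. field.
Qed.

(** The Schwarz function [w] is a preimage chosen point by point. It is continuous by
    [quadratic_form_bound], hence differentiable by [cder_inverse], the derivative [1 - w^2] being
    nonzero in the disc; injectivity gives [w 0 = 0]. *)
Lemma subordinate_phi_Ne (p : C -> C) :
  analytic_on_disc p -> p 0%C = 1%C ->
  (forall z, Cmod z < 1 -> Cmod (p z - 1) < 2 / 3) ->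
  subordinate p phi_Ne.
Proof.
  intros Hp P0 Hb. split; [exact Hp|]. split.
  { apply analytic_on_disc_cder. intros z _. eexists.
    apply cder_ext with (fun y => 1 + (y - y ^ 3 / 3))%C.
    - intros y. unfold phi_Ne. ring.
    - apply cder_plus; [apply cder_const|apply cder_nephroid]. }
  assert (Hex : forall z, exists x, Cmod z < 1 ->
     Cmod x < 1 /\ (x - x ^ 3 / 3)%C = (p z - 1)%C).
  { intros z. destruct (Rlt_or_le (Cmod z) 1) as [Hz|Hz].
    - destruct (nephroid_preimage _ (Hb z Hz)) as [x Hx]. exists x. auto.
    - exists 0%C. intros. lra. }
  set (w := fun z => proj1_sig (constructive_indefinite_description _ (Hex z))).
  assert (Hw : forall z, Cmod z < 1 ->
     Cmod (w z) < 1 /\ (w z - w z ^ 3 / 3)%C = (p z - 1)%C).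
  { intros z. exact (proj2_sig (constructive_indefinite_description _ (Hex z))). }
  clearbody w. exists w. split; [|split; [|split]].
  - apply analytic_on_disc_cder. intros z Hz.
    destruct (proj1 (analytic_on_disc_cder p) Hp z Hz) as [d D].
    destruct (Hw z Hz) as [W1 W2].
    exists ((d - 0) / (1 - w z * w z))%C.
    apply (cder_inverse (fun y => y - y ^ 3 / 3)%C w (fun y => p y - 1)%C).
    + apply (cnear_imp _ (fun y => Cmod y < 1)); [|apply cnear_lt, Hz].
      intros y Hy. apply Hw, Hy.
    + intros eps He. set (q := (1 - Cmod (w z)) / 3).
      assert (Hq : 0 < q) by (unfold q; lra).
      assert (N : cnear z (fun y => Cmod y < 1 /\ Cmod (p y - p z) < eps * q)).
      { apply cnear_and; [apply cnear_lt, Hz|].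
        apply (cder_ccont _ _ _ D). nra. }
      revert N. apply cnear_imp. intros y [Hy Hpy].
      destruct (Hw y Hy) as [V1 V2].
      pose proof (quadratic_form_bound (w y) (w z) V1 W1) as Q. fold q in Q.
      pose proof (cube_difference (w y) (w z)) as E. rewrite V2, W2 in E.
      replace (p y - 1 - (p z - 1))%C with (p y - p z)%C in E by ring.
      rewrite E, Cmod_mult in Hpy. pose proof (Cmod_ge_0 (w y - w z)).
      apply (Rmult_lt_reg_r q); [exact Hq|]. nra.
    + apply cder_nephroid.
    + intros E. assert (E' : (w z * w z)%C = 1%C).
      { replace (w z * w z)%C with (1 - (1 - w z * w z))%C by ring.
        rewrite E. ring. }
      apply (f_equal Cmod) in E'. rewrite Cmod_mult, Cmod_1 in E'.
      pose proof (Cmod_ge_0 (w z)). nra.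
    + apply cder_minus; [exact D|apply cder_const].
  - assert (H0 : Cmod 0 < 1) by (rewrite Cmod_0; lra).
    destruct (Hw 0%C H0) as [W1 W2].
    apply nephroid_injective; [exact W1|exact H0|].
    rewrite W2, P0. simpl. field.
  - intros z Hz. apply Hw, Hz.
  - intros z Hz. unfold phi_Ne. destruct (Hw z Hz) as [_ W2].
    replace (p z) with (1 + (p z - 1))%C by ring. rewrite <- W2. ring.
Qed.

(** * Janowski subordinations *)

Lemma one_plus_RtoC_mult_neq_0 (B : R) (z : C) :
  Rabs B < 1 -> Cmod z < 1 -> (1 + B * z)%C <> 0%C.
Proof.
  intros HB Hz. apply Re_pos_neq_0, Re_one_plus_pos. rewrite Cmod_mult, Cmod_R.
  pose proof (Cmod_ge_0 z). pose proof (Rabs_pos B). nra.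
Qed.

Lemma RtoC_neq_0 (x : R) : x <> 0 -> RtoC x <> 0%C.
Proof. intros H E. apply H, RtoC_inj, E. Qed.

(** Both sides equal [1 + (A - B) z / (1 + B z)]; the right one displays the constant [c] of the
    logarithm. *)
Lemma janowski_expand (A B beta : R) (z : C) :
  beta <> 0 -> B <> 0 -> Rabs B < 1 -> Cmod z < 1 ->
  janowski A B z
  = (1 + beta * (((A - B) / (beta * B))%R * (B * z) / (1 + B * z)))%C.
Proof.
  intros Hb HB0 HB Hz. unfold janowski.
  assert (HbB : (beta * B)%R <> 0) by (apply Rmult_integral_contrapositive; auto).
  rewrite RtoC_div, RtoC_mult, RtoC_minus by exact HbB.
  field. repeat split; try (apply RtoC_neq_0; assumption).
  apply one_plus_RtoC_mult_neq_0; assumption.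
Qed.

(** [E z = z F' z] is the expression whose image under [1 + beta .] is
    subordinate to the Janowski function. *)
Lemma primitive_log_form (A B beta r : R) (G E F F1 : C -> C) :
  0 < beta -> B < A -> B <> 0 -> Rabs B < 1 -> r <= 1 ->
  subordinate G (janowski A B) ->
  (forall z, Cmod z < r -> G z = 1 + beta * E z)%C ->
  F 0%C = 0%C ->
  (forall z, Cmod z < r -> cder F z (F1 z)) ->
  (forall z, Cmod z < r -> z * F1 z = E z)%C ->
  forall z, Cmod z < r ->
    exists v : C, Cmod v < Rabs B /\
      F z = (((A - B) / (beta * B))%R * Clog (1 + v))%C.
Proof.
  intros Hb HBA HB0 HB Hr (GA & _ & w & _ & _ & Hw & Hsub) HG F0 FD HE.
  set (c := (A - B) / (beta * B)).
  assert (Hc : c <> 0).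
  { apply Rmult_integral_contrapositive. split; [lra|].
    apply Rinv_neq_0_compat, Rmult_integral_contrapositive. split; [lra|exact HB0]. }
  assert (Hbc : RtoC beta <> 0%C) by (apply RtoC_neq_0; lra).
  apply (subordination_log F F1 w c B r Hc); try assumption.
  - split; [apply Rabs_pos_lt, HB0|exact HB].
  (* Away from the origin [F1 y = (G y - 1) / (beta y)], and [G] is analytic as part of the
     subordination. *)
  - intros z Hz0 Hz. exists F1. split.
    + apply (cnear_imp _ _ _ FD), cnear_lt, Hz.
    + destruct (proj1 (analytic_on_disc_cder G) GA z ltac:(lra)) as [d D].
      assert (Hdiv : exists d', cder (fun y => (/ beta * (G y - 1)) / y)%C z d').
      { eexists. apply cder_div; [exact Hz0| |apply cder_id].
        apply cder_scal, cder_minus; [exact D|apply cder_const]. }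
      destruct Hdiv as [d' D']. exists d'.
      revert D'. apply cder_ext_loc.
      apply (cnear_imp _ (fun y => Cmod y < r /\ y <> 0%C)).
      * intros y [Hy Hy0]. rewrite HG, <- HE by exact Hy. field. auto.
      * apply cnear_and; [apply cnear_lt, Hz|].
        apply (ccont_neq0 (fun y => y)); [apply ccont_id|exact Hz0].
  - intros z Hz. apply Hw. lra.
  - intros z Hz. rewrite HE by exact Hz.
    assert (Hz1 : Cmod z < 1) by lra.
    pose proof (Hsub z Hz1) as S. rewrite HG in S by exact Hz.
    rewrite (janowski_expand A B beta) in S by (auto; lra). fold c in S.
    assert (S' : E z = (c * (B * w z) / (1 + B * w z))%C).
    { replace (E z) with (/ beta * ((1 + beta * E z) - 1))%C by (field; exact Hbc).
      rewrite S. field. split; [|exact Hbc].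
      apply one_plus_RtoC_mult_neq_0; auto. }
    rewrite S'. field. apply one_plus_RtoC_mult_neq_0; auto.
Qed.

(** * Sufficiency for the three expressions *)

Lemma analytic_C_derive (p : C -> C) (z : C) :
  analytic_on_disc p -> Cmod z < 1 -> cder p z (C_derive p z).
Proof.
  intros Hp Hz. apply cder_is_derive, C_derive_correct; [exact z|].
  apply Hp, Hz.
Qed.

Lemma c_mult_B_pos (A B beta : R) :
  0 < beta -> B < A -> B <> 0 -> 0 < (A - B) / (beta * B) * B.
Proof.
  intros Hb HBA HB. replace ((A - B) / (beta * B) * B) with ((A - B) / beta)
    by (field; split; lra).
  apply Rdiv_lt_0_compat; lra.
Qed.

(** The bounds on [beta] are replaced by their meaning: the real range of [c log (1 + B x)] stays
    within [[- t1, t2]]. *)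
Definition dominated_implication
    (expr : R -> (C -> C) -> C -> C) (A B t1 t2 : R) : Prop :=
  forall (beta : R) (p : C -> C),
    0 < beta ->
    - t1 <= (A - B) / (beta * B) * ln (1 - B) ->
    (A - B) / (beta * B) * ln (1 + B) <= t2 ->
    analytic_on_disc p -> p 0%C = 1%C ->
    subordinate (expr beta p) (janowski A B) ->
    subordinate p phi_Ne.

(** Here [F = p - 1] is defined whatever the zeros of [p], so the whole disc is treated at once. *)
Lemma dominated_a (A B : R) :
  B < A -> B <> 0 -> Rabs B < 1 -> dominated_implication expr_a A B (2 / 3) (2 / 3).
Proof.
  intros HBA HB0 HB beta p Hb H1 H2 Hp P0 Hs.
  apply subordinate_phi_Ne; auto. intros z Hz.
  destruct (primitive_log_form A B beta 1 _ (fun y => y * C_derive p y)%C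
    (fun y => p y - 1)%C (C_derive p) Hb HBA HB0 HB (Rle_refl 1) Hs) with z
    as [v [Hv E]]; auto.
  - rewrite P0. ring.
  - intros y Hy. eapply cder_eq.
    + apply cder_minus; [apply analytic_C_derive; eassumption|apply cder_const].
    + ring.
  - rewrite E. eapply Rlt_le_trans.
    + apply (scaled_Clog_bound B); auto. apply c_mult_B_pos; assumption.
    + apply Rmax_lub; lra.
Qed.

Lemma Re_pos_near_1 (z : C) : Cmod (z - 1) < 1 -> 0 < Re z.
Proof.
  intros H. replace z with (1 + (z - 1))%C by ring. apply Re_one_plus_pos, H.
Qed.

(** With [F = log p], the ends [- ln 3] and [ln (5/3)] are mapped by [exp] to [1/3] and [5/3], both
    at distance [2/3] from [1]. *)
Lemma dominated_b (A B : R) :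
  B < A -> B <> 0 -> Rabs B < 1 ->
  dominated_implication expr_b A B (ln 3) (ln (5 / 3)).
Proof.
  intros HBA HB0 HB beta p Hb H1 H2 Hp P0 Hs.
  apply subordinate_phi_Ne; auto. apply bootstrap; [|exact P0|].
  { intros z Hz. exact (cder_ccont _ _ _ (analytic_C_derive p z Hp Hz)). }
  intros r Hr Hnear z Hz.
  assert (Hpos : forall y, Cmod y < r -> 0 < Re (p y))
    by (intros y Hy; apply Re_pos_near_1, Hnear, Hy).
  destruct (primitive_log_form A B beta r _ (fun y => y * C_derive p y / p y)%C
    (fun y => Clog (p y)) (fun y => / p y * C_derive p y)%C
    Hb HBA HB0 HB Hr Hs) with z as [v [Hv E]]; auto.
  - rewrite P0. apply Clog_1.
  - intros y Hy. apply (cder_comp Clog p); [apply cder_Clog, Hpos, Hy|].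
    apply analytic_C_derive; [exact Hp|lra].
  - intros y Hy. unfold Cdiv. ring.
  - rewrite <- (cexp_Clog (p z)), E by (apply Hpos, Hz). eapply Rlt_le_trans.
    + apply (scaled_power_bound B); auto. apply c_mult_B_pos; assumption.
    + apply Rmax_lub.
      * apply exp_monotone in H1. rewrite exp_Ropp, exp_ln in H1 by lra. lra.
      * apply exp_monotone in H2. rewrite (exp_ln (5 / 3)) in H2 by lra. lra.
Qed.

Lemma dominated_c (A B : R) :
  B < A -> B <> 0 -> Rabs B < 1 -> dominated_implication expr_c A B 2 (2 / 5).
Proof.
  intros HBA HB0 HB beta p Hb H1 H2 Hp P0 Hs.
  apply subordinate_phi_Ne; auto. apply bootstrap; [|exact P0|].
  { intros z Hz. exact (cder_ccont _ _ _ (analytic_C_derive p z Hp Hz)). }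
  intros r Hr Hnear z Hz.
  assert (Hne : forall y, Cmod y < r -> p y <> 0%C)
    by (intros y Hy; apply Re_pos_neq_0, Re_pos_near_1, Hnear, Hy).
  destruct (primitive_log_form A B beta r _ (fun y => y * C_derive p y / p y ^ 2)%C
    (fun y => 1 - / p y)%C (fun y => C_derive p y / (p y * p y))%C
    Hb HBA HB0 HB Hr Hs) with z as [v [Hv E]]; auto.
  - rewrite P0. field.
  - intros y Hy. eapply cder_eq.
    + apply cder_minus; [apply cder_const|].
      apply cder_inv; [apply Hne, Hy|].
      apply analytic_C_derive; [exact Hp|lra].
    + field. apply Hne, Hy.
  - intros y Hy. simpl. field. apply Hne, Hy.
  - pose proof (inversion_bound B _ v (c_mult_B_pos A B beta Hb HBA HB0) HB Hv H1 H2)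
      as K.
    rewrite <- E in K. specialize (Hne z Hz).
    (* Since [1 - F = 1/p], multiplying the bound on [F] by [|p|] turns it into [3 |p - 1| < 2]. *)
    replace (1 - (1 - / p z))%C with (/ p z)%C in K by ring.
    replace (1 - / p z)%C with ((p z - 1) / p z)%C in K by (field; exact Hne).
    rewrite Cmod_div, Cmod_inv in K by exact Hne.
    assert (Hm : 0 < Cmod (p z)) by (apply Cmod_gt_0, Hne).
    apply (Rmult_lt_compat_r (Cmod (p z))) in K; [|exact Hm].
    replace (2 * / Cmod (p z) * Cmod (p z)) with 2 in K by (field; lra).
    replace (3 * (Cmod (p z - 1) / Cmod (p z)) * Cmod (p z))
      with (3 * Cmod (p z - 1)) in K by (field; lra).
    lra.
Qed.

(** * From ranges of the logarithm to bounds on [beta] *)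

Lemma ln_one_plus_div_pos (B : R) : B <> 0 -> -1 < B -> 0 < ln (1 + B) / B.
Proof.
  intros HB0 HB. destruct (Rlt_or_le 0 B) as [H|H].
  - apply Rdiv_lt_0_compat; [|exact H]. rewrite <- ln_1. apply ln_increasing; lra.
  - assert (ln (1 + B) < 0) by (rewrite <- ln_1; apply ln_increasing; lra).
    replace (ln (1 + B) / B) with (- ln (1 + B) / - B) by (field; exact HB0).
    apply Rdiv_lt_0_compat; lra.
Qed.

(** The value of [beta] at which [c * L = t], where [c = (A - B) / (beta * B)]. Every bound of the
    theorem has this form. *)
Definition threshold (A B t L : R) : R := (A - B) / (B * t) * L.

Lemma threshold_le (A B t L beta : R) :
  0 < t -> 0 < beta -> B <> 0 ->
  threshold A B t L <= beta <-> (A - B) / (beta * B) * L <= t.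
Proof.
  intros Ht Hb HB. unfold threshold.
  replace ((A - B) / (B * t) * L) with ((A - B) / (beta * B) * L * (beta / t))
    by (field; lra).
  assert (Hq : 0 < beta / t) by (apply Rdiv_lt_0_compat; assumption).
  assert (E : beta = t * (beta / t)) by (field; lra).
  split; intros H.
  - rewrite E in H at 3. apply Rmult_le_reg_r in H; assumption.
  - rewrite E at 3. apply Rmult_le_compat_r; lra.
Qed.

Lemma threshold_positive (A B t : R) :
  0 < t -> -1 < B -> B < A -> B <> 0 -> 0 < threshold A B t (ln (1 + B)).
Proof.
  intros Ht HB HBA HB0. unfold threshold.
  replace ((A - B) / (B * t) * ln (1 + B)) with ((A - B) / t * (ln (1 + B) / B))
    by (field; lra).
  apply Rmult_lt_0_compat; [apply Rdiv_lt_0_compat; lra|].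
  apply ln_one_plus_div_pos; assumption.
Qed.

Lemma implication_from_thresholds expr (A B t1 t2 : R) :
  0 < t1 -> 0 < t2 -> -1 < B -> B < A -> A <= 1 -> B <> 0 ->
  dominated_implication expr A B t1 t2 ->
  implication_from expr A B
    (Rmax (threshold A B t1 (ln (/ (1 - B)))) (threshold A B t2 (ln (1 + B)))).
Proof.
  intros H1 H2 HB HBA HA HB0 Hd beta p Hbeta.
  assert (K1 : threshold A B t1 (ln (/ (1 - B))) <= beta)
    by (eapply Rle_trans; [apply Rmax_l|exact Hbeta]).
  assert (K2 : threshold A B t2 (ln (1 + B)) <= beta)
    by (eapply Rle_trans; [apply Rmax_r|exact Hbeta]).
  (* The statement admits any real [beta]; its positivity is extracted from the second bound. *)
  pose proof (threshold_positive A B t2 H2 HB HBA HB0).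
  assert (Hb : 0 < beta) by lra.
  apply threshold_le in K1; auto. apply threshold_le in K2; auto.
  rewrite ln_Rinv in K1 by lra. apply Hd; lra.
Qed.

(** * Sharpness *)

(** For [z = a + i b] the imaginary part is [b (1 - a^2 + b^2/3)], whose second factor is positive
    in the disc. Hence real values come from real [z], and [a - a^3/3] stays strictly between [-2/3]
    and [2/3]. *)
Lemma nephroid_real_values (z : C) (x : R) :
  Cmod z < 1 -> (z - z ^ 3 / 3)%C = RtoC x -> Rabs x < 2 / 3.
Proof.
  intros Hz E. destruct z as [a b].
  assert (Hab : a ^ 2 + b ^ 2 < 1).
  { pose proof (Cmod2_alt (a, b)) as M. simpl (Re _) in M. simpl (Im _) in M.
    rewrite <- M. pose proof (Cmod_ge_0 (a, b)). nra. }
  assert (E3 : (((a, b) - x) * 3)%C = ((a, b) ^ 3)%C).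
  { rewrite <- E. field. }
  pose proof (f_equal snd E3) as EI. pose proof (f_equal fst E3) as ER.
  simpl in EI, ER.
  assert (Hb : b = 0).
  { assert (H : b * (1 - a ^ 2 + b ^ 2 / 3) = 0) by nra.
    apply Rmult_integral in H. destruct H as [H|H]; [exact H|nra]. }
  subst b. assert (Ex : x = a - a ^ 3 / 3) by lra.
  assert (Ha : -1 < a < 1) by nra.
  rewrite Ex. apply Rabs_def1; nra.
Qed.

(** The equation is solved explicitly by [1 + B x = exp (t / c)]. As [c] and [B] have the same sign,
    the two ends of the range correspond to [x = -1] and [x = 1] in this order. *)
Lemma log_value_attained (B c t : R) :
  0 < c * B -> Rabs B < 1 ->
  c * ln (1 - B) < t < c * ln (1 + B) ->
  exists x, -1 < x < 1 /\ 0 < 1 + B * x /\ c * ln (1 + B * x) = t.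
Proof.
  intros HcB HB Ht. apply Rabs_def2 in HB.
  assert (Hc : c <> 0) by (intros E; rewrite E in HcB; lra).
  assert (HB0 : B <> 0) by (intros E; rewrite E in HcB; lra).
  set (e := exp (t / c)). assert (He : 0 < e) by apply exp_pos.
  assert (El : c * ln e = t) by (unfold e; rewrite ln_exp; field; exact Hc).
  exists ((e - 1) / B).
  replace (1 + B * ((e - 1) / B)) with e by (field; exact HB0).
  split; [|split; [exact He|exact El]].
  rewrite <- El in Ht.
  assert (Hq : e - 1 = (e - 1) / B * B) by (field; exact HB0).
  destruct (Rlt_or_le 0 B) as [H|H].
  - assert (0 < c) by nra.
    assert (1 - B < e) by (apply ln_lt_inv; nra).
    assert (e < 1 + B) by (apply ln_lt_inv; nra).
    split; nra.
  - assert (c < 0) by nra.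
    assert (e < 1 - B) by (apply ln_lt_inv; nra).
    assert (1 + B < e) by (apply ln_lt_inv; nra).
    split; nra.
Qed.

(** [Th] is the map taking [F] to [p]. The bound with [10/9] gives room below the critical [beta]
    while keeping the denominator [1 - F] of (c) away from zero. *)
Definition extremal_family
    (expr : R -> (C -> C) -> C -> C) (A B t2 : R) (Th : R -> R) : Prop :=
  forall beta : R, 0 < beta ->
    (A - B) / (beta * B) * ln (1 + B) <= 10 / 9 * t2 ->
    exists p : C -> C, analytic_on_disc p /\ p 0%C = 1%C /\
      subordinate (expr beta p) (janowski A B) /\
      forall x : R, -1 < x < 1 -> 0 < 1 + B * x ->
        p (RtoC x) = RtoC (Th ((A - B) / (beta * B) * ln (1 + B * x))).

(** Below the threshold the real range of [F] passes [- t1] or [t2], so the extremal [p] takes the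
    value [1/3] or [5/3] at a real point, and [phi_Ne] takes neither value in the open disc. *)
Lemma best_possible_thresholds expr (A B t1 t2 : R) (Th : R -> R) :
  0 < t1 -> 0 < t2 -> -1 < B -> B < A -> A <= 1 -> B <> 0 ->
  extremal_family expr A B t2 Th -> Th (- t1) = 1 / 3 -> Th t2 = 5 / 3 ->
  best_possible expr A B
    (Rmax (threshold A B t1 (ln (/ (1 - B)))) (threshold A B t2 (ln (1 + B)))).
Proof.
  intros H1 H2 HB HBA HA HB0 Hex HT1 HT2 b Hb Himp.
  set (b1 := threshold A B t1 (ln (/ (1 - B)))) in *.
  set (b2 := threshold A B t2 (ln (1 + B))) in *.
  assert (P2 : 0 < b2) by (apply threshold_positive; assumption).
  set (b0 := Rmax b1 b2) in *.
  assert (H20 : b2 <= b0) by apply Rmax_r.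
  (* Since [b] may be negative or far too small, the test value is raised to at least [9/10] of the
     threshold; this makes it positive and gives the factor [10/9] in [H109]. *)
  set (beta := Rmax b (9 / 10 * b0)).
  assert (K1 : b <= beta) by apply Rmax_l.
  assert (K2 : 9 / 10 * b0 <= beta) by apply Rmax_r.
  assert (K3 : beta < b0) by (apply Rmax_lub_lt; lra).
  assert (Hbeta : 0 < beta) by lra.
  assert (HBa : Rabs B < 1) by (apply Rabs_def1; lra).
  set (c := (A - B) / (beta * B)).
  assert (HcB : 0 < c * B) by (apply c_mult_B_pos; assumption).
  assert (H109 : c * ln (1 + B) <= 10 / 9 * t2).
  { apply threshold_le; [lra|exact Hbeta|exact HB0|].
    replace (threshold A B (10 / 9 * t2) (ln (1 + B))) with (9 / 10 * b2)
      by (unfold b2, threshold; field; lra).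
    lra. }
  destruct (Hex beta Hbeta H109) as (p & Hp & P0 & Hs & Hx). fold c in Hx.
  destruct (Himp beta p K1 Hp P0 Hs) as (_ & _ & w & _ & _ & Hw & Hpw).
  assert (Hno : forall x, -1 < x < 1 -> 0 < 1 + B * x ->
     Rabs (Th (c * ln (1 + B * x)) - 1) < 2 / 3).
  { intros x Hx1 Hx2.
    assert (Hm : Cmod (RtoC x) < 1) by (rewrite Cmod_R; apply Rabs_def1; lra).
    apply (nephroid_real_values (w (RtoC x))); [apply Hw, Hm|].
    rewrite RtoC_minus, <- Hx, Hpw by assumption. unfold phi_Ne. ring. }
  assert (Hlp : 0 < c * ln (1 + B)).
  { replace (c * ln (1 + B)) with (c * B * (ln (1 + B) / B)) by (field; exact HB0).
    apply Rmult_lt_0_compat; [exact HcB|apply ln_one_plus_div_pos; assumption]. }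
  assert (Hlm : c * ln (1 - B) < 0).
  { replace (c * ln (1 - B)) with (- (c * B * (ln (1 + - B) / - B)))
      by (unfold Rminus; field; exact HB0).
    apply Ropp_lt_gt_0_contravar, Rmult_lt_0_compat; [exact HcB|].
    apply ln_one_plus_div_pos; lra. }
  assert (Hor : c * ln (1 - B) < - t1 \/ t2 < c * ln (1 + B)).
  { apply NNPP. intros Hn. apply (Rlt_not_le _ _ K3). apply Rmax_lub.
    - apply threshold_le; auto. rewrite ln_Rinv by lra. fold c. lra.
    - apply threshold_le; auto. fold c. lra. }
  destruct Hor as [Hor|Hor].
  - destruct (log_value_attained B c (- t1) HcB HBa) as (x & X1 & X2 & X3); [lra|].
    specialize (Hno x X1 X2). rewrite X3, HT1, Rabs_left in Hno; lra.
  - destruct (log_value_attained B c t2 HcB HBa) as (x & X1 & X2 & X3); [lra|].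
    specialize (Hno x X1 X2). rewrite X3, HT2, Rabs_pos_eq in Hno; lra.
Qed.

Lemma analytic_janowski (A B : R) : Rabs B < 1 -> analytic_on_disc (janowski A B).
Proof.
  intros HB. apply analytic_on_disc_cder. intros z Hz. eexists.
  apply cder_div; [apply one_plus_RtoC_mult_neq_0; assumption| |];
    (apply cder_plus; [apply cder_const|apply cder_scal, cder_id]).
Qed.

Lemma subordinate_janowski_self (A B : R) (f : C -> C) :
  Rabs B < 1 -> (forall z, Cmod z < 1 -> f z = janowski A B z) ->
  subordinate f (janowski A B).
Proof.
  intros HB Hf. split; [|split; [apply analytic_janowski, HB|]].
  - apply analytic_on_disc_cder. intros z Hz.
    destruct (proj1 (analytic_on_disc_cder _) (analytic_janowski A B HB) z Hz)
      as [d D].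
    exists d. revert D. apply cder_ext_loc.
    apply (cnear_imp _ (fun y => Cmod y < 1)); [|apply cnear_lt, Hz].
    intros y Hy. symmetry. apply Hf, Hy.
  - exists (fun z => z). split; [|auto].
    apply analytic_on_disc_cder. intros z _. exists 1%C. apply cder_id.
Qed.

(** The extremal [F], corresponding to the Schwarz function [w z = z]. *)
Definition log_form (c B : R) (z : C) : C := (c * Clog (1 + B * z))%C.

Lemma cder_log_form (c B : R) (z : C) :
  Rabs B < 1 -> Cmod z < 1 -> cder (log_form c B) z (c * B / (1 + B * z))%C.
Proof.
  intros HB Hz. eapply cder_eq.
  - apply cder_scal, (cder_comp (fun x => Clog (1 + x))%C (fun y => B * y)%C).
    + apply cder_Clog_one_plus. rewrite Cmod_mult, Cmod_R.
      pose proof (Cmod_ge_0 z). pose proof (Rabs_pos B). nra.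
    + apply cder_scal, cder_id.
  - field. apply one_plus_RtoC_mult_neq_0; assumption.
Qed.

Lemma log_form_0 (c B : R) : log_form c B 0 = 0%C.
Proof.
  unfold log_form. rewrite Cmult_0_r, Cplus_0_r, Clog_1. ring.
Qed.

Lemma log_form_RtoC (c B x : R) :
  0 < 1 + B * x -> log_form c B x = RtoC (c * ln (1 + B * x)).
Proof.
  intros H. unfold log_form. rewrite <- RtoC_mult, <- RtoC_plus, Clog_RtoC by exact H.
  rewrite <- RtoC_mult. reflexivity.
Qed.

Lemma cder_C_derive (f : C -> C) (z d : C) : cder f z d -> C_derive f z = d.
Proof. intros H. apply is_C_derive_unique, cder_is_derive, H. Qed.

Lemma extremal_a (A B : R) :
  B < A -> B <> 0 -> Rabs B < 1 ->
  extremal_family expr_a A B (2 / 3) (fun x => 1 + x).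
Proof.
  intros HBA HB0 HB beta Hb _. set (c := (A - B) / (beta * B)).
  assert (D : forall z, Cmod z < 1 ->
     cder (fun y => 1 + log_form c B y)%C z (c * B / (1 + B * z))%C).
  { intros z Hz. eapply cder_eq.
    - apply cder_plus; [apply cder_const|apply cder_log_form; assumption].
    - ring. }
  exists (fun y => 1 + log_form c B y)%C. split; [|split; [|split]].
  - apply analytic_on_disc_cder. intros z Hz. eexists. apply D, Hz.
  - rewrite log_form_0. ring.
  - apply subordinate_janowski_self; [exact HB|]. intros z Hz.
    rewrite (janowski_expand A B beta) by (auto; lra). fold c.
    unfold expr_a. rewrite (cder_C_derive _ _ _ (D z Hz)). unfold Cdiv. ring.
  - intros x _ Hx. rewrite log_form_RtoC by exact Hx.
    rewrite RtoC_plus. reflexivity.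
Qed.

Lemma extremal_b (A B : R) :
  B < A -> B <> 0 -> Rabs B < 1 ->
  extremal_family expr_b A B (ln (5 / 3)) exp.
Proof.
  intros HBA HB0 HB beta Hb _. set (c := (A - B) / (beta * B)).
  assert (D : forall z, Cmod z < 1 -> cder (fun y => cexp (log_form c B y)) z
      (cexp (log_form c B z) * (c * B / (1 + B * z)))%C).
  { intros z Hz. apply (cder_comp cexp); [apply cder_cexp|].
    apply cder_log_form; assumption. }
  exists (fun y => cexp (log_form c B y)). split; [|split; [|split]].
  - apply analytic_on_disc_cder. intros z Hz. eexists. apply D, Hz.
  - rewrite log_form_0. apply cexp_0.
  - apply subordinate_janowski_self; [exact HB|]. intros z Hz.
    rewrite (janowski_expand A B beta) by (auto; lra). fold c.
    unfold expr_b. rewrite (cder_C_derive _ _ _ (D z Hz)). field.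
    split; [apply one_plus_RtoC_mult_neq_0; assumption|apply cexp_neq_0].
  - intros x _ Hx. rewrite log_form_RtoC by exact Hx. apply cexp_RtoC.
Qed.

(** The real part is [c ln |1 + B z|]. For [B > 0] the modulus is below [1 + B]; for [B < 0] it is
    above [1 + B], and the negative [c] reverses the inequality. *)
Lemma Re_log_form_le (c B : R) (z : C) :
  0 < c * B -> Rabs B < 1 -> Cmod z < 1 ->
  Re (log_form c B z) <= c * ln (1 + B).
Proof.
  intros HcB HB Hz. unfold log_form. rewrite re_scal_l.
  change (Re (Clog (1 + B * z))) with (ln (Cmod (1 + B * z))).
  assert (Hp : 0 < Cmod (1 + B * z))
    by (apply Cmod_gt_0, one_plus_RtoC_mult_neq_0; assumption).
  pose proof (Cmod_one_plus_upper (B * z)) as U.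
  pose proof (Cmod_one_plus_lower (B * z)) as L.
  rewrite Cmod_mult, Cmod_R in U, L. pose proof (Cmod_ge_0 z).
  destruct (Rlt_or_le 0 B) as [HB0|HB0].
  - rewrite Rabs_pos_eq in * by lra. apply Rmult_le_compat_l; [nra|].
    apply ln_le; nra.
  - rewrite Rabs_left1 in * by lra. assert (c < 0) by nra.
    assert (ln (1 + B) <= ln (Cmod (1 + B * z))) by (apply ln_le; nra).
    nra.
Qed.

Lemma extremal_c (A B : R) :
  B < A -> B <> 0 -> Rabs B < 1 ->
  extremal_family expr_c A B (2 / 5) (fun x => / (1 - x)).
Proof.
  intros HBA HB0 HB beta Hb Hc. set (c := (A - B) / (beta * B)) in *.
  assert (HcB : 0 < c * B) by (apply c_mult_B_pos; assumption).
  (* The real part of the logarithmic form is at most [10/9 * 2/5 = 4/9 < 1]. *)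
  assert (N : forall z, Cmod z < 1 -> (1 - log_form c B z)%C <> 0%C).
  { intros z Hz. apply Re_pos_neq_0. unfold Cminus. rewrite re_plus, re_opp.
    pose proof (Re_log_form_le c B z HcB HB Hz). simpl (Re 1). lra. }
  assert (D : forall z, Cmod z < 1 -> cder (fun y => / (1 - log_form c B y))%C z
      (c * B / (1 + B * z) / ((1 - log_form c B z) * (1 - log_form c B z)))%C).
  { intros z Hz. eapply cder_eq.
    - apply cder_inv; [apply N, Hz|].
      apply cder_minus; [apply cder_const|apply cder_log_form; assumption].
    - cbv beta. field. split; [apply one_plus_RtoC_mult_neq_0; assumption|apply N, Hz]. }
  exists (fun y => / (1 - log_form c B y))%C. split; [|split; [|split]].
  - apply analytic_on_disc_cder. intros z Hz. eexists. apply D, Hz.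
  - rewrite log_form_0. field.
  - apply subordinate_janowski_self; [exact HB|]. intros z Hz.
    rewrite (janowski_expand A B beta) by (auto; lra). fold c.
    unfold expr_c. rewrite (cder_C_derive _ _ _ (D z Hz)). simpl. field.
    split; [apply one_plus_RtoC_mult_neq_0; assumption|apply N, Hz].
  - intros x Hx1 Hx.
    assert (Hm : Cmod (RtoC x) < 1) by (rewrite Cmod_R; apply Rabs_def1; lra).
    specialize (N x Hm). rewrite log_form_RtoC in N |- * by exact Hx.
    rewrite <- RtoC_minus in N |- *. rewrite RtoC_inv; [reflexivity|].
    intros E. apply N. rewrite E. reflexivity.
Qed.

Theorem theorem4p1 (A B : R)
    (hB : -1 < B) (hBA : B < A) (hA : A <= 1) (hB0 : B <> 0) :
  (let beta1 := (A - B) / (2 * B) * ln (/ (1 - B) ^ 3) in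
   let beta2 := (A - B) / (2 * B) * ln ((1 + B) ^ 3) in
   implication_from expr_a A B (Rmax beta1 beta2) /\
   best_possible expr_a A B (Rmax beta1 beta2)) /\
  (let beta1 := (A - B) / (B * ln 3) * ln (/ (1 - B)) in
   let beta2 := (A - B) / (B * ln (5 / 3)) * ln (1 + B) in
   implication_from expr_b A B (Rmax beta1 beta2) /\
   best_possible expr_b A B (Rmax beta1 beta2)) /\
  (let beta1 := (A - B) / (2 * B) * ln (/ (1 - B)) in
   let beta2 := (A - B) / (2 * B) * ln ((1 + B) ^ 5) in
   implication_from expr_c A B (Rmax beta1 beta2) /\
   best_possible expr_c A B (Rmax beta1 beta2)).
Proof.
  assert (HB : Rabs B < 1) by (apply Rabs_def1; lra).
  assert (L3 : 0 < ln 3) by (rewrite <- ln_1; apply ln_increasing; lra).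
  assert (L53 : 0 < ln (5 / 3)) by (rewrite <- ln_1; apply ln_increasing; lra).
  cbv zeta. split; [|split].
  (* The exponent [3], and likewise the [5] of part (c), moves out of the logarithm and turns the
     divisor [2] into [t = 2/3], respectively [2/5]. *)
  - replace ((A - B) / (2 * B) * ln (/ (1 - B) ^ 3))
      with (threshold A B (2 / 3) (ln (/ (1 - B)))).
    2:{ rewrite <- pow_inv, ln_pow by (apply Rinv_0_lt_compat; lra).
        unfold threshold. simpl INR. field. exact hB0. }
    replace ((A - B) / (2 * B) * ln ((1 + B) ^ 3))
      with (threshold A B (2 / 3) (ln (1 + B))).
    2:{ rewrite ln_pow by lra. unfold threshold. simpl INR. field. exact hB0. }
    split.
    + apply implication_from_thresholds; auto; try lra. apply dominated_a; auto.
    + apply (best_possible_thresholds _ _ _ _ _ (fun x => 1 + x)); auto; try lra.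
      apply extremal_a; auto.
  - change ((A - B) / (B * ln 3) * ln (/ (1 - B)))
      with (threshold A B (ln 3) (ln (/ (1 - B)))).
    change ((A - B) / (B * ln (5 / 3)) * ln (1 + B))
      with (threshold A B (ln (5 / 3)) (ln (1 + B))).
    split.
    + apply implication_from_thresholds; auto. apply dominated_b; auto.
    + apply (best_possible_thresholds _ _ _ _ _ exp); auto.
      * apply extremal_b; auto.
      * rewrite exp_Ropp, exp_ln; lra.
      * apply exp_ln. lra.
  - replace ((A - B) / (2 * B) * ln (/ (1 - B)))
      with (threshold A B 2 (ln (/ (1 - B)))).
    2:{ unfold threshold. field. exact hB0. }
    replace ((A - B) / (2 * B) * ln ((1 + B) ^ 5))
      with (threshold A B (2 / 5) (ln (1 + B))).
    2:{ rewrite ln_pow by lra. unfold threshold. simpl INR. field. exact hB0. }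
    split.
    + apply implication_from_thresholds; auto; try lra. apply dominated_c; auto.
    + apply (best_possible_thresholds _ _ _ _ _ (fun x => / (1 - x))); auto;
        try lra.
      * apply extremal_c; auto.
      * field.
Qed.
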